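(* Let $s\in(0,1)$ and let $f$ be the meromorphic function $$f(\beta)=\frac{\Gamma(\beta+1)\sin(\pi s)}{\Gamma(\beta-2s+1)\sin(\pi(\beta-2s))}\left(\frac{\sin(\pi(\beta-s))}{\sin(\pi s)}+\frac{\Gamma(2s-\beta)\Gamma(\beta+1)}{\Gamma(2s)}\right),\qquad \beta\in\mathbb{C}.$$ Then: (i) If $s\le\frac12$, then $f$ has no zeros in the strip $\{0<\mathrm{Re}(\beta)<2s+\alpha\}$ for some small $\alpha>0$. Moreover, $f$ has at least one zero in the strip $\{2s<\mathrm{Re}(\beta)<2s+\frac12\}$. (ii) If $s\ge\frac12$, then $f$ has no zeros in the strip $\{2s-1<\mathrm{Re}(\beta)<s+\frac12+\alpha\}$ for some small $\alpha>0$. Moreover, $f$ has at least one zero in the strip $\{s+\frac12<\mathrm{Re}(\beta)<s+1\}$.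
   Context: $\Gamma$ is the Euler Gamma function; zeros are zeros of $f$ as a meromorphic function on $\mathbb{C}$ (with removable singularities removed). The number $\alpha$ may depend on $s$. *)

(* Defs.v *)
From Stdlib Require Import Reals Factorial.
From Coquelicot Require Import Coquelicot.

Open Scope R_scope.

Definition Cexp (z : C) : C :=
  (exp (Re z) * cos (Im z), exp (Re z) * sin (Im z)).

Definition Csin (z : C) : C :=
  ((Cexp (Ci * z) - Cexp (- (Ci * z))) / (2 * Ci))%C.

(* z (z + 1) ... (z + n), with n + 1 factors. *)
Fixpoint Crising (z : C) (n : nat) : C :=
  match n with
  | O => z
  | S m => (Crising z m * (z + INR n))%C
  end.

(* n! n^z / (z (z + 1) ... (z + n)); the term n = 0, where [ln 0] is a
   conventional value, does not affect the limit. *)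
Definition Gamma_seq (z : C) (n : nat) : C :=
  (INR (fact n) * Cexp (z * ln (INR n)) / Crising z n)%C.

(* Euler's limit, which converges for every z except 0, -1, -2, ...  The value
   at these poles is a conventional one and carries no meaning. *)
Definition CGamma (z : C) : C :=
  (real (Lim_seq (fun n => Re (Gamma_seq z n))),
   real (Lim_seq (fun n => Im (Gamma_seq z n)))).

(* z0 is a zero of the meromorphic function given, away from a discrete set,
   by the total function f: the singularity of f at z0 is removable, and the
   holomorphic extension vanishes at z0.  The value [f z0] itself is not used,
   since it is a conventional one when a Gamma factor has a pole at z0 or a
   denominator vanishes there. *)
Definition meromorphic_zero (f : C -> C) (z0 : C) : Prop :=
  exists g : C -> C,
    locally z0 (fun z => ex_derive (K := C_AbsRing) (V := C_NormedModule) g z) /\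
    locally' z0 (fun z => g z = f z) /\
    g z0 = 0%C.

Definition f_s (s : R) (beta : C) : C :=
  (CGamma (beta + 1) * Csin (PI * s)
     / (CGamma (beta - 2 * s + 1) * Csin (PI * (beta - 2 * s)))
   * (Csin (PI * (beta - s)) / Csin (PI * s)
      + CGamma (2 * s - beta) * CGamma (beta + 1) / CGamma (2 * s)))%C.

(* Main.v *)
Require Import Defs.
From Stdlib Require Import Reals Factorial Lra Lia ClassicalEpsilon.
From Coquelicot Require Import Coquelicot.
Open Scope R_scope.

(* By Gamma(z) = Gamma(z + 1) / z, on the strip max(0, 2s - 1) < Re b < 2s + 1 the
   function f is, up to a zero-free factor with the single pole 2s,
     sin(pi (b - s)) (b - 2s) - sin(pi s) Gamma(2s + 1 - b) Gamma(b + 1) / Gamma(2s).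
   On every vertical line the modulus of the first term increases and that of the second
   one decreases with |Im b|, and the argument of the Gamma term for Im b > 0 lies
   between 0 and pi (Re b - s) when s < Re b <= 2s. Comparing arguments excludes zeros up to the line
   Re b = s + min(s, 1/2), and compactness gives the margin alpha. To the right of that
   line the two terms, if they do not already agree at a real point, have the same
   modulus along the graph of a continuous function of Re b; the difference of their
   arguments is positive at its left end and negative at its right end (distance 1/2),
   so that it vanishes in between. *)

(** * Complex differentiability *)

(** The number min(s, 1/2) has two sources: up to Re b = 2 s the factor b - 2 s has real part at
    most 0, and from the symmetry line up to Re b = s + 1/2 the sine sin(pi (b - s)) has nonnegative
    imaginary part for Im b > 0. Arguments have to be compared as real numbers, not modulo 2 pi.
    Gamma is therefore carried as the exponential of a logarithm whose imaginary part [lam] is a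
    limit of sums of arctangents, one per factor of Euler's product, hence continuous on the right
    half-plane. Monotonicity, convexity and a quadratic Taylor bound are proved for the terms of
    Euler's limit, with constants independent of n, and then passed to the limit. Because moduli are
    strictly monotone in Im b, the search for a zero becomes a one-variable intermediate value
    argument and needs neither contour integrals nor an argument principle. *)

Lemma im_le_Cmod (z : C) : Rabs (Im z) <= Cmod z.
Proof.
  eapply Rle_trans; [apply Rmax_r | apply Rmax_Cmod].
Qed.

Lemma Cmod_le_parts (z : C) : Cmod z <= Rabs (Re z) + Rabs (Im z).
Proof.
  assert (H := Rabs_pos (fst z)); assert (H' := Rabs_pos (snd z)).
  unfold Cmod, Re, Im; rewrite <- (sqrt_pow2 (Rabs (fst z) + Rabs (snd z))) by lra.
  apply sqrt_le_1_alt; rewrite <- (pow2_abs (fst z)), <- (pow2_abs (snd z)); nra.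
Qed.

Lemma C_eq_parts (z w : C) : Re z = Re w -> Im z = Im w -> z = w.
Proof. destruct z, w; simpl; congruence. Qed.

Lemma continuous_C_pair {U : UniformSpace} (f g : U -> R) (x : U) :
  continuous f x -> continuous g x ->
  continuous (U := C_UniformSpace) (fun t => (f t, g t)) x.
Proof.
  intros Hf Hg.
  apply (continuous_comp_2 (X := C_UniformSpace) f g (fun a b => (a, b))); auto.
  apply (continuous_ext (fun p : R * R => p)).
  - now intros [].
  - apply continuous_id.
Qed.

Lemma continuous_Re {U : UniformSpace} (f : U -> C) (x : U) :
  continuous (U := C_UniformSpace) f x -> continuous (fun t => Re (f t)) x.
Proof.
  intros H; apply (continuous_comp (V := C_UniformSpace) f fst); auto.
  apply continuous_fst.
Qed.

Lemma continuous_Im {U : UniformSpace} (f : U -> C) (x : U) :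
  continuous (U := C_UniformSpace) f x -> continuous (fun t => Im (f t)) x.
Proof.
  intros H; apply (continuous_comp (V := C_UniformSpace) f snd); auto.
  apply continuous_snd.
Qed.

Lemma continuous_Cplus {U : UniformSpace} (f g : U -> C) (x : U) :
  continuous (U := C_UniformSpace) f x -> continuous (U := C_UniformSpace) g x ->
  continuous (U := C_UniformSpace) (fun t => f t + g t)%C x.
Proof.
  intros Hf Hg.
  assert (Hf1 := continuous_Re f x Hf); assert (Hf2 := continuous_Im f x Hf).
  assert (Hg1 := continuous_Re g x Hg); assert (Hg2 := continuous_Im g x Hg).
  apply continuous_C_pair; now apply (continuous_plus (V := R_NormedModule)).
Qed.

Lemma continuous_Copp {U : UniformSpace} (f : U -> C) (x : U) :
  continuous (U := C_UniformSpace) f x ->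
  continuous (U := C_UniformSpace) (fun t => - f t)%C x.
Proof.
  intros Hf.
  assert (Hf1 := continuous_Re f x Hf); assert (Hf2 := continuous_Im f x Hf).
  apply continuous_C_pair; now apply (continuous_opp (V := R_NormedModule)).
Qed.

Lemma continuous_Cmult {U : UniformSpace} (f g : U -> C) (x : U) :
  continuous (U := C_UniformSpace) f x -> continuous (U := C_UniformSpace) g x ->
  continuous (U := C_UniformSpace) (fun t => f t * g t)%C x.
Proof.
  intros Hf Hg.
  assert (continuous (fun t => fst (f t)) x) by now apply continuous_Re.
  assert (continuous (fun t => fst (g t)) x) by now apply continuous_Re.
  assert (continuous (fun t => snd (f t)) x) by now apply continuous_Im.
  assert (continuous (fun t => snd (g t)) x) by now apply continuous_Im.
  apply continuous_C_pair.
  - apply (continuous_minus (V := R_NormedModule));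
      now apply (continuous_mult (K := R_AbsRing)).
  - apply (continuous_plus (V := R_NormedModule));
      now apply (continuous_mult (K := R_AbsRing)).
Qed.

Lemma continuous_Rdiv {U : UniformSpace} (f g : U -> R) (x : U) :
  continuous f x -> continuous g x -> g x <> 0 -> continuous (fun t => f t / g t) x.
Proof.
  intros Hf Hg H; apply (continuous_mult (K := R_AbsRing)); auto.
  apply (continuous_comp g Rinv); auto.
  now apply continuous_Rinv.
Qed.

Lemma sum_sqr_pos (x y : R) : x <> 0 \/ y <> 0 -> 0 < x ^ 2 + y ^ 2.
Proof.
  intros [H | H]; assert (H1 := pow2_ge_0 x); assert (H2 := pow2_ge_0 y);
    [assert (0 < x ^ 2) | assert (0 < y ^ 2)]; try lra; now apply pow2_gt_0.
Qed.

Lemma C_neq_0 (z : C) : z <> 0%C -> Re z <> 0 \/ Im z <> 0.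
Proof.
  intros H; destruct (Req_dec (Re z) 0) as [H1 | H1]; [right | now left].
  intros H2; apply H; now apply C_eq_parts.
Qed.

Lemma continuous_Cinv {U : UniformSpace} (f : U -> C) (x : U) :
  continuous (U := C_UniformSpace) f x -> f x <> 0%C ->
  continuous (U := C_UniformSpace) (fun t => / f t)%C x.
Proof.
  intros Hf H.
  assert (H1 : continuous (fun t => fst (f t)) x) by now apply continuous_Re.
  assert (H2 : continuous (fun t => snd (f t)) x) by now apply continuous_Im.
  assert (H3 := sum_sqr_pos _ _ (C_neq_0 _ H)); unfold Re, Im in H3.
  assert (H4 : continuous (fun t => fst (f t) ^ 2 + snd (f t) ^ 2) x).
  { apply (continuous_plus (V := R_NormedModule)).
    - apply (continuous_comp (fun t => fst (f t)) (fun u => u ^ 2)); auto.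
      apply (ex_derive_continuous (V := R_NormedModule)); auto_derive; auto.
    - apply (continuous_comp (fun t => snd (f t)) (fun u => u ^ 2)); auto.
      apply (ex_derive_continuous (V := R_NormedModule)); auto_derive; auto. }
  apply continuous_C_pair; apply continuous_Rdiv; auto; try lra.
  now apply (continuous_opp (V := R_NormedModule)).
Qed.

(** [C_UniformSpace] has product balls, while [ex_derive] over [C_AbsRing] uses discs; [locally_C]
    identifies their neighbourhoods. Continuity is always taken in the product structure, where
    components are at hand. *)
Lemma locally_C_disc (z : C) (P : C -> Prop) :
  locally (T := C_UniformSpace) z P <->
  exists delta, 0 < delta /\ forall w, Cmod (w - z) < delta -> P w.
Proof.
  rewrite (locally_C z P); split.
  - intros [d Hd]; exists d; split; [apply cond_pos |]; exact Hd.
  - intros [d [H Hd]]; exists (mkposreal d H); exact Hd.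
Qed.

Lemma locally_Cmod (z : C) (delta : R) :
  0 < delta -> locally (T := C_UniformSpace) z (fun w => Cmod (w - z) < delta).
Proof. intros H; apply locally_C_disc; eauto. Qed.

Lemma continuous_C_eps (f : C -> C) (z : C) :
  continuous (T := C_UniformSpace) (U := C_UniformSpace) f z <->
  forall eps, 0 < eps -> exists delta, 0 < delta /\
    forall w, Cmod (w - z) < delta -> Cmod (f w - f z) < eps.
Proof.
  split.
  - intros H eps He.
    specialize (H _ (locally_Cmod (f z) eps He)).
    now apply locally_C_disc in H.
  - intros H P HP; apply locally_C_disc in HP; destruct HP as [e [He HP]].
    destruct (H e He) as [d [Hd Hd']].
    apply locally_C_disc; exists d; split; auto.
Qed.

(* Caratheodory's form of differentiability at [z]; it makes the product, chain
   and quotient rules statements about continuity. *)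
Definition cdiff (f : C -> C) (z : C) : Prop :=
  exists phi : C -> C,
    continuous (T := C_UniformSpace) (U := C_UniformSpace) phi z /\
    locally (T := C_UniformSpace) z (fun w => f w = (f z + (w - z) * phi w)%C).

Lemma cdiff_ex_derive (f : C -> C) (z : C) :
  cdiff f z -> ex_derive (K := C_AbsRing) (V := C_NormedModule) f z.
Proof.
  intros [phi [Hc Hf]]; exists (phi z); split.
  - apply (is_linear_scal_l (K := C_AbsRing) (V := C_NormedModule)).
  - intros x Hx eps.
    assert (Hz : z = x)
      by now apply (is_filter_lim_locally_unique
                      (K := C_AbsRing) (V := AbsRing_NormedModule C_AbsRing)).
    subst x.
    apply (locally_C z (fun y => norm (minus (minus (f y) (f z)) (scal (minus y z) (phi z)))
      <= eps * norm (minus y z))).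
    rewrite continuous_C_eps in Hc; destruct (Hc eps (cond_pos eps)) as [d [Hd Hc']].
    generalize (filter_and _ _ Hf (locally_Cmod z d Hd)); apply filter_imp.
    intros w [Hw1 Hw2].
    change (Cmod (f w - f z - (w - z) * phi z) <= eps * Cmod (w - z)).
    rewrite Hw1.
    replace (f z + (w - z) * phi w - f z - (w - z) * phi z)%C
      with ((phi w - phi z) * (w - z))%C by ring.
    rewrite Cmod_mult; apply Rmult_le_compat_r; [apply Cmod_ge_0 |].
    now apply Rlt_le, Hc'.
Qed.

Lemma ex_derive_C_continuous (f : C -> C) (z : C) :
  ex_derive (K := C_AbsRing) (V := C_NormedModule) f z ->
  continuous (T := C_UniformSpace) (U := C_UniformSpace) f z.
Proof.
  intros H; apply ex_derive_continuous in H.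
  intros P HP; apply locally_C; exact (H P HP).
Qed.

Lemma continuous_Cconst {U : UniformSpace} (a : C) (x : U) :
  continuous (U := C_UniformSpace) (fun _ => a) x.
Proof. apply continuous_const. Qed.

Lemma cdiff_continuous (f : C -> C) (z : C) :
  cdiff f z -> continuous (T := C_UniformSpace) (U := C_UniformSpace) f z.
Proof.
  intros [phi [Hc Hf]].
  apply continuous_ext_loc with (fun w : C => f z + (w - z) * phi w)%C.
  - revert Hf; apply filter_imp; intros; symmetry; auto.
  - apply continuous_Cplus; [apply continuous_Cconst |].
    apply continuous_Cmult; auto.
    apply continuous_Cplus; [apply continuous_id | apply continuous_Cconst].
Qed.

Lemma cdiff_const (a z : C) : cdiff (fun _ => a) z.
Proof.
  exists (fun _ => 0%C); split; [apply continuous_Cconst |].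
  apply filter_forall; intros w; change C in w; ring.
Qed.

Lemma cdiff_id (z : C) : cdiff (fun w => w) z.
Proof.
  exists (fun _ => 1%C); split; [apply continuous_Cconst |].
  apply filter_forall; intros w; change C in w; ring.
Qed.

Lemma cdiff_plus (f g : C -> C) (z : C) :
  cdiff f z -> cdiff g z -> cdiff (fun w => f w + g w)%C z.
Proof.
  intros [phi [Hc Hf]] [psi [Hc' Hg]].
  exists (fun w => phi w + psi w)%C; split; [now apply continuous_Cplus |].
  generalize (filter_and _ _ Hf Hg); apply filter_imp; intros w [-> ->]; ring.
Qed.

Lemma cdiff_mult (f g : C -> C) (z : C) :
  cdiff f z -> cdiff g z -> cdiff (fun w => f w * g w)%C z.
Proof.
  intros Hf Hg; assert (Hcf := cdiff_continuous _ _ Hf).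
  destruct Hf as [phi [Hc Hf]], Hg as [psi [Hc' Hg]].
  exists (fun w => phi w * g z + f w * psi w)%C; split.
  - apply continuous_Cplus; apply continuous_Cmult; auto; apply continuous_Cconst.
  - generalize (filter_and _ _ Hf Hg); apply filter_imp; intros w [-> ->]; ring.
Qed.

Lemma cdiff_opp (f : C -> C) (z : C) : cdiff f z -> cdiff (fun w => - f w)%C z.
Proof.
  intros [phi [Hc Hf]]; exists (fun w => - phi w)%C; split; [now apply continuous_Copp |].
  revert Hf; apply filter_imp; intros w ->; ring.
Qed.

Lemma cdiff_minus (f g : C -> C) (z : C) :
  cdiff f z -> cdiff g z -> cdiff (fun w => f w - g w)%C z.
Proof. intros; apply cdiff_plus; auto; now apply cdiff_opp. Qed.

Lemma cdiff_comp (f g : C -> C) (z : C) :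
  cdiff f (g z) -> cdiff g z -> cdiff (fun w => f (g w)) z.
Proof.
  intros [phi [Hc Hf]] Hg; assert (Hcg := cdiff_continuous _ _ Hg).
  destruct Hg as [psi [Hc' Hg]].
  assert (Hcg' : locally (T := C_UniformSpace) z (fun w => f (g w) = (f (g z) + (g w - g z) * phi (g w))%C))
    by exact (Hcg _ Hf).
  exists (fun w => psi w * phi (g w))%C; split.
  - apply continuous_Cmult; auto.
    now apply (continuous_comp (V := C_UniformSpace) (W := C_UniformSpace) g phi).
  - generalize (filter_and _ _ Hcg' Hg); apply filter_imp; intros w [H1 H2].
    change C in w; rewrite H1.
    assert (E : (g w - g z = (w - z) * psi w)%C) by (rewrite H2; ring).
    rewrite E; ring.
Qed.

Lemma cdiff_ext_loc (f g : C -> C) (z : C) :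
  locally (T := C_UniformSpace) z (fun w => f w = g w) -> cdiff f z -> cdiff g z.
Proof.
  intros H [phi [Hc Hf]]; exists phi; split; auto.
  assert (Hz := locally_singleton _ _ H); simpl in Hz.
  generalize (filter_and _ _ H Hf); apply filter_imp; intros w [H1 H2].
  now rewrite <- Hz, <- H1.
Qed.

Lemma continuous_C_neq_0 (f : C -> C) (z : C) :
  continuous (T := C_UniformSpace) (U := C_UniformSpace) f z -> f z <> 0%C ->
  locally (T := C_UniformSpace) z (fun w => f w <> 0%C).
Proof.
  intros Hc H; apply locally_C_disc.
  rewrite continuous_C_eps in Hc.
  destruct (Hc (Cmod (f z))) as [d [Hd Hw]]; [now apply Cmod_gt_0 |].
  exists d; split; auto; intros w H1 H2; specialize (Hw w H1); rewrite H2 in Hw.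
  replace (0 - f z)%C with (- f z)%C in Hw by ring.
  rewrite Cmod_opp in Hw; lra.
Qed.

Lemma cdiff_inv (f : C -> C) (z : C) :
  cdiff f z -> f z <> 0%C -> cdiff (fun w => / f w)%C z.
Proof.
  intros Hf H; assert (Hcf := cdiff_continuous _ _ Hf).
  destruct Hf as [phi [Hc Hf]].
  exists (fun w => - (phi w * / f w * / f z))%C; split.
  - apply continuous_Copp, continuous_Cmult; [| apply continuous_Cconst].
    apply continuous_Cmult; auto; now apply continuous_Cinv.
  - generalize (filter_and _ _ Hf (continuous_C_neq_0 _ _ Hcf H)).
    apply filter_imp; intros w [H1 H2].
    assert (E : ((w - z) * phi w = f w - f z)%C) by (rewrite H1; ring).
    replace ((w - z) * - (phi w * / f w * / f z))%C
      with (- ((w - z) * phi w) * / f w * / f z)%C by ring.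
    rewrite E; field; auto.
Qed.

Lemma cdiff_div (f g : C -> C) (z : C) :
  cdiff f z -> cdiff g z -> g z <> 0%C -> cdiff (fun w => f w / g w)%C z.
Proof. intros; apply cdiff_mult; auto; now apply cdiff_inv. Qed.

(** The form in which differentiability of [Cexp] and [lgam] is proved: unlike a limit of difference
    quotients, an inequality with a fixed constant survives a pointwise limit. *)
Lemma cdiff_quadratic (f : C -> C) (z l : C) (r K : R) :
  0 < r ->
  (forall h, Cmod h < r -> Cmod (f (z + h) - f z - h * l)%C <= K * Cmod h ^ 2) ->
  cdiff f z.
Proof.
  intros Hr H.
  (* The slope, filled in by [l] at [z]; the bound divided by |w - z| gives |phi w - l| <= K |w -
     z|. *)
  set (phi := fun w => if excluded_middle_informative (w = z) then l
                       else ((f w - f z) / (w - z))%C).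
  assert (Hphi : forall w, w <> z -> (f w - f z = (w - z) * phi w)%C).
  { intros w Hw; unfold phi; destruct excluded_middle_informative; [easy |].
    field; intros E; apply Hw.
    replace w with (w - z + z)%C by ring; rewrite E; ring. }
  assert (Hz : phi z = l) by (unfold phi; now destruct excluded_middle_informative).
  exists phi; split.
  - apply continuous_C_eps; intros eps He; rewrite Hz.
    assert (HK : 0 < Rabs K + 1) by (assert (H0 := Rabs_pos K); lra).
    exists (Rmin r (eps / (Rabs K + 1))); split.
    + apply Rmin_pos; auto; now apply Rdiv_lt_0_compat.
    + intros w Hw.
      assert (Hw1 := Rlt_le_trans _ _ _ Hw (Rmin_l _ _)).
      assert (Hw2 := Rlt_le_trans _ _ _ Hw (Rmin_r _ _)).
      destruct (excluded_middle_informative (w = z)) as [-> | Hn].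
      { rewrite Hz; replace (l - l)%C with (RtoC 0) by ring; now rewrite Cmod_0. }
      specialize (H _ Hw1).
      replace (z + (w - z))%C with w in H by ring.
      rewrite (Hphi w Hn) in H.
      replace ((w - z) * phi w - (w - z) * l)%C with ((w - z) * (phi w - l))%C in H by ring.
      rewrite Cmod_mult in H.
      assert (Hp : 0 < Cmod (w - z)).
      { apply Cmod_gt_0; intros E; apply Hn.
        replace w with (w - z + z)%C by ring; rewrite E; ring. }
      apply Rmult_lt_compat_l with (r := Rabs K + 1) in Hw2; auto.
      replace ((Rabs K + 1) * (eps / (Rabs K + 1))) with eps in Hw2 by (field; lra).
      apply Rle_lt_trans with (2 := Hw2).
      apply Rmult_le_reg_l with (1 := Hp).
      apply Rle_trans with (1 := H).
      assert (HK' := Rle_abs K).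
      replace (Cmod (w - z) * ((Rabs K + 1) * Cmod (w - z)))
        with ((Rabs K + 1) * Cmod (w - z) ^ 2) by ring.
      apply Rmult_le_compat_r; [apply pow2_ge_0 | lra].
  - apply filter_forall; intros w; change C in w.
    destruct (excluded_middle_informative (w = z)) as [-> | Hn]; [ring |].
    rewrite <- (Hphi w Hn); ring.
Qed.

(** * The complex exponential and sine *)

Lemma Cexp_add (z w : C) : Cexp (z + w) = (Cexp z * Cexp w)%C.
Proof.
  destruct z as [a b], w as [c d]; unfold Cexp, Cplus, Cmult; simpl.
  rewrite exp_plus, cos_plus, sin_plus; f_equal; ring.
Qed.

Lemma Cexp_neq_0 (z : C) : Cexp z <> 0%C.
Proof.
  intros H; assert (E := f_equal Cmod H); rewrite Cmod_0 in E.
  revert E; unfold Cexp, Cmod; simpl.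
  set (e := exp (Re z)); set (a := cos (Im z)); set (b := sin (Im z)).
  assert (H1 : b² + a² = 1) by apply sin2_cos2; unfold Rsqr in H1.
  replace (_ + _) with (e ^ 2) by (transitivity (e ^ 2 * (b * b + a * a)); [rewrite H1 |]; ring).
  rewrite sqrt_pow2 by (left; apply exp_pos).
  unfold e; generalize (exp_pos (Re z)); lra.
Qed.

(** The mean value equality fails for complex values, so complex increments are bounded
    componentwise along a segment parametrized by [0, 1]. *)
Lemma MVT_01_bound (f df : R -> R) (A M : R) :
  A = f 1 - f 0 ->
  (forall t, 0 <= t <= 1 -> is_derive f t (df t)) ->
  (forall t, 0 <= t <= 1 -> Rabs (df t) <= M) ->
  Rabs A <= M.
Proof.
  intros -> Hd Hb; destruct (MVT_gen f 0 1 df) as [c [Hc E]];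
    rewrite ?Rmin_left, ?Rmax_right in * by lra.
  - intros; apply Hd; lra.
  - intros; apply derivable_continuous_pt.
    exists (df x); now apply is_derive_Reals, Hd.
  - rewrite E, Rminus_0_r, Rmult_1_r; now apply Hb.
Qed.

(** The derivative of exp(t h) - t h is h (exp(t h) - 1), and exp(t h) - 1 is itself O(|h|), so the
    mean value bound is used twice. Each use adds two terms per component, whence 4 e per component
    and 8 e in all. *)
Lemma Cexp_quadratic (h : C) : Cmod h <= 1 -> Cmod (Cexp h - 1 - h) <= 8 * exp 1 * Cmod h ^ 2.
Proof.
  intros Hh.
  assert (Ha := re_le_Cmod h); assert (Hb := im_le_Cmod h); assert (Hp := Cmod_ge_0 h).
  destruct h as [a b]; simpl in Ha, Hb; set (m := Cmod (a, b)) in *.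
  assert (He : forall t, 0 <= t <= 1 -> 0 < exp (t * a) <= exp 1).
  { intros t Ht; split; [apply exp_pos |].
    assert (t * a <= 1); [| destruct H; [left; now apply exp_increasing | right; now f_equal]].
    apply Rle_trans with (Rabs (t * a)); [apply Rle_abs |].
    rewrite Rabs_mult, (Rabs_pos_eq t) by lra; assert (H' := Rabs_pos a); nra. }
  assert (Hb1 : forall u, Rabs (cos u) <= 1)
    by (intros u; apply Rabs_le; assert (H := COS_bound u); lra).
  assert (Hb2 : forall u, Rabs (sin u) <= 1)
    by (intros u; apply Rabs_le; assert (H := SIN_bound u); lra).
  assert (Hbd : forall t u v A, 0 <= t <= 1 -> Rabs u <= 1 -> Rabs v <= A ->
     Rabs (v * (exp (t * a) * u)) <= A * exp 1).
  { intros t u v A Ht Hu Hv; rewrite !Rabs_mult.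
    specialize (He t Ht); rewrite (Rabs_pos_eq (exp _)) by lra.
    assert (H1 := Rabs_pos u); assert (H2 := Rabs_pos v).
    apply Rmult_le_compat; auto; [apply Rmult_le_pos; lra |].
    rewrite <- (Rmult_1_r (exp 1)); apply Rmult_le_compat; lra. }
  assert (S1 : forall t, 0 <= t <= 1 -> Rabs (exp (t * a) * cos (t * b) - 1) <= 2 * m * exp 1).
  { intros t Ht.
    apply MVT_01_bound with (f := fun r => exp (r * t * a) * cos (r * t * b)) (df := fun r =>
      (t * a) * (exp ((r * t) * a) * cos (r * t * b)) +
      (- t * b) * (exp ((r * t) * a) * sin (r * t * b))).
    - rewrite !Rmult_0_l, exp_0, cos_0, !Rmult_1_l; ring.
    - intros r Hr; auto_derive; auto; ring.
    - intros r Hr; eapply Rle_trans; [apply Rabs_triang |].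
      assert (0 <= r * t <= 1) by nra.
      assert (Rabs (t * a) <= m)
        by (rewrite Rabs_mult, (Rabs_pos_eq t) by lra; assert (H' := Rabs_pos a); nra).
      assert (Rabs (- t * b) <= m)
        by (rewrite Rabs_mult, Rabs_Ropp, (Rabs_pos_eq t) by lra;
            assert (H' := Rabs_pos b); nra).
      assert (K1 := Hbd (r * t) (cos (r * t * b)) (t * a) m H (Hb1 _) H0).
      assert (K2 := Hbd (r * t) (sin (r * t * b)) (- t * b) m H (Hb2 _) H1).
      lra. }
  assert (S2 : forall t, 0 <= t <= 1 -> Rabs (exp (t * a) * sin (t * b)) <= 2 * m * exp 1).
  { intros t Ht.
    apply MVT_01_bound with (f := fun r => exp (r * t * a) * sin (r * t * b)) (df := fun r =>
      (t * a) * (exp ((r * t) * a) * sin (r * t * b)) +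
      (t * b) * (exp ((r * t) * a) * cos (r * t * b))).
    - rewrite !Rmult_0_l, exp_0, sin_0, !Rmult_1_l; ring.
    - intros r Hr; auto_derive; auto; ring.
    - intros r Hr; eapply Rle_trans; [apply Rabs_triang |].
      assert (0 <= r * t <= 1) by nra.
      assert (Rabs (t * a) <= m)
        by (rewrite Rabs_mult, (Rabs_pos_eq t) by lra; assert (H' := Rabs_pos a); nra).
      assert (Rabs (t * b) <= m)
        by (rewrite Rabs_mult, (Rabs_pos_eq t) by lra;
            assert (H' := Rabs_pos b); nra).
      assert (K1 := Hbd (r * t) (sin (r * t * b)) (t * a) m H (Hb2 _) H0).
      assert (K2 := Hbd (r * t) (cos (r * t * b)) (t * b) m H (Hb1 _) H1).
      lra. }
  assert (He1 := exp_pos 1).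
  eapply Rle_trans; [apply Cmod_le_parts |]; simpl.
  assert (T1 : Rabs (exp a * cos b - 1 - a) <= 4 * m ^ 2 * exp 1).
  { apply MVT_01_bound with (f := fun t => exp (t * a) * cos (t * b) - t * a) (df := fun t =>
      a * (exp (t * a) * cos (t * b) - 1) - b * (exp (t * a) * sin (t * b))).
    - rewrite !Rmult_0_l, exp_0, cos_0, !Rmult_1_l; ring.
    - intros t Ht; auto_derive; auto; ring.
    - intros t Ht; unfold Rminus at 1; eapply Rle_trans; [apply Rabs_triang |].
      rewrite Rabs_Ropp, (Rabs_mult a), (Rabs_mult b).
      specialize (S1 t Ht); specialize (S2 t Ht).
      assert (H1 := Rabs_pos a); assert (H2 := Rabs_pos b).
      assert (H3 := Rabs_pos (exp (t * a) * cos (t * b) - 1)).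
      assert (H4 := Rabs_pos (exp (t * a) * sin (t * b))).
      assert (Rabs a * Rabs (exp (t * a) * cos (t * b) - 1) <= m * (2 * m * exp 1))
        by (apply Rmult_le_compat; auto).
      assert (Rabs b * Rabs (exp (t * a) * sin (t * b)) <= m * (2 * m * exp 1))
        by (apply Rmult_le_compat; auto).
      nra. }
  assert (T2 : Rabs (exp a * sin b - b) <= 4 * m ^ 2 * exp 1).
  { apply MVT_01_bound with (f := fun t => exp (t * a) * sin (t * b) - t * b) (df := fun t =>
      b * (exp (t * a) * cos (t * b) - 1) + a * (exp (t * a) * sin (t * b))).
    - rewrite !Rmult_0_l, exp_0, sin_0, !Rmult_1_l; ring.
    - intros t Ht; auto_derive; auto; ring.
    - intros t Ht; eapply Rle_trans; [apply Rabs_triang |].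
      rewrite (Rabs_mult b), (Rabs_mult a).
      specialize (S1 t Ht); specialize (S2 t Ht).
      assert (H1 := Rabs_pos a); assert (H2 := Rabs_pos b).
      assert (H3 := Rabs_pos (exp (t * a) * cos (t * b) - 1)).
      assert (H4 := Rabs_pos (exp (t * a) * sin (t * b))).
      assert (Rabs b * Rabs (exp (t * a) * cos (t * b) - 1) <= m * (2 * m * exp 1))
        by (apply Rmult_le_compat; auto).
      assert (Rabs a * Rabs (exp (t * a) * sin (t * b)) <= m * (2 * m * exp 1))
        by (apply Rmult_le_compat; auto).
      nra. }
  replace (exp a * sin b + - 0 + - b) with (exp a * sin b - b) by ring.
  replace (exp a * cos b + - (1) + - a) with (exp a * cos b - 1 - a) by ring.
  assert (0 <= m ^ 2 * exp 1) by (apply Rmult_le_pos; [apply pow2_ge_0 | lra]).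
  lra.
Qed.

Lemma cdiff_Cexp (z : C) : cdiff Cexp z.
Proof.
  apply (cdiff_quadratic _ _ (Cexp z) 1 (Cmod (Cexp z) * (8 * exp 1))); [lra |].
  intros h Hh; rewrite Cexp_add.
  replace (Cexp z * Cexp h - Cexp z - h * Cexp z)%C with (Cexp z * (Cexp h - 1 - h))%C by ring.
  rewrite Cmod_mult, Rmult_assoc.
  apply Rmult_le_compat_l; [apply Cmod_ge_0 | apply Cexp_quadratic; lra].
Qed.

Lemma cdiff_Csin (z : C) : cdiff Csin z.
Proof.
  apply cdiff_mult; [| apply cdiff_const].
  apply cdiff_minus; apply (cdiff_comp Cexp); try apply cdiff_Cexp;
    try apply cdiff_opp; apply cdiff_mult; auto using cdiff_const, cdiff_id.
Qed.

Lemma Csin_parts (x y : R) :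
  Csin (x, y) = (sin x * cosh y, cos x * sinh y).
Proof.
  unfold Csin, Cexp, cosh, sinh; simpl.
  replace (0 * x - 1 * y) with (- y) by ring.
  replace (0 * y + 1 * x) with x by ring.
  rewrite Ropp_involutive, cos_neg, sin_neg.
  apply C_eq_parts; simpl; field.
Qed.

(** * Logarithm of Gamma *)

(** The principal logarithm; the arctangent is the argument only for Re z > 0. *)
Definition Clog (z : C) : C := (ln (Re z ^ 2 + Im z ^ 2) / 2, atan (Im z / Re z)).

Lemma exp_half_ln (u : R) : 0 < u -> exp (ln u / 2) = sqrt u.
Proof.
  intros Hu; rewrite <- (sqrt_pow2 (exp _)) by (left; apply exp_pos); f_equal.
  simpl; rewrite Rmult_1_r, <- exp_plus.
  replace (ln u / 2 + ln u / 2) with (ln u) by field.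
  now apply exp_ln.
Qed.

Lemma atan_div_polar (x y : R) : 0 < x ->
  cos (atan (y / x)) = x / sqrt (x ^ 2 + y ^ 2) /\ sin (atan (y / x)) = y / sqrt (x ^ 2 + y ^ 2).
Proof.
  intros Hx; assert (Hp : 0 < x ^ 2 + y ^ 2) by (apply sum_sqr_pos; lra).
  assert (E : sqrt (1 + (y / x)²) = sqrt (x ^ 2 + y ^ 2) / x).
  { transitivity (sqrt (x ^ 2 + y ^ 2) / sqrt (x * x)); [| now rewrite sqrt_square by lra].
    rewrite <- sqrt_div by nra; f_equal; unfold Rsqr; field; lra. }
  assert (Hs := sqrt_lt_R0 _ Hp).
  rewrite cos_atan, sin_atan, E; split; field; lra.
Qed.

Lemma Cexp_Clog (z : C) : 0 < Re z -> Cexp (Clog z) = z.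
Proof.
  destruct z as [x y]; unfold Cexp, Clog, Re, Im, fst, snd; intros Hx.
  assert (Hp : 0 < x ^ 2 + y ^ 2) by (apply sum_sqr_pos; lra).
  destruct (atan_div_polar x y Hx) as [-> ->]; rewrite exp_half_ln by easy.
  assert (Hs := sqrt_lt_R0 _ Hp); f_equal; field; lra.
Qed.

(** The derivative of log(p + t h) - t h / p in t is - t h^2 / ((p + t h) p), of modulus at most
    |h|^2 / m^2 because real parts stay at least m on the segment. The factor 2 adds the two
    components. *)
Lemma Clog_quadratic (p h : C) (m : R) :
  0 < m -> m <= Re p -> m <= Re (p + h) ->
  Cmod (Clog (p + h) - Clog p - h / p) <= 2 * Cmod h ^ 2 / m ^ 2.
Proof.
  intros Hm H0 H1.
  assert (Hpos : forall t, 0 <= t <= 1 -> m <= Re (p + t * h)).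
  { intros t Ht; destruct p, h; simpl in *; nra. }
  assert (Hge : forall t, 0 <= t <= 1 -> m <= Cmod (p + t * h)).
  { intros t Ht; eapply Rle_trans; [now apply Hpos |].
    eapply Rle_trans; [apply Rle_abs | apply re_le_Cmod]. }
  assert (Hn : forall t, 0 <= t <= 1 -> (p + t * h)%C <> 0%C).
  { intros t Ht; apply Cmod_gt_0; specialize (Hge t Ht); lra. }
  assert (Hmp : m <= Cmod p).
  { specialize (Hge 0 ltac:(lra)); now replace (p + RtoC 0 * h)%C with p in Hge by ring. }
  assert (Hp : p <> 0%C) by (apply Cmod_gt_0; lra).
  assert (Hb : forall t, 0 <= t <= 1 -> Cmod (h / (p + t * h) - h / p) <= Cmod h ^ 2 / m ^ 2).
  { intros t Ht.
    replace (h / (p + t * h) - h / p)%C with (- (t * h * h / ((p + t * h) * p)))%C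
      by (field; split; auto).
    rewrite Cmod_opp, Cmod_div by (apply Cmult_neq_0; auto).
    rewrite !Cmod_mult, Cmod_R, (Rabs_pos_eq t) by lra.
    assert (Hh := Cmod_ge_0 h); specialize (Hge t Ht).
    apply Rmult_le_compat.
    - apply Rmult_le_pos; auto; apply Rmult_le_pos; lra.
    - left; apply Rinv_0_lt_compat, Rmult_lt_0_compat; lra.
    - assert (0 <= Cmod h * Cmod h) by nra; nra.
    - apply Rinv_le_contravar; [nra |].
      simpl; rewrite Rmult_1_r; apply Rmult_le_compat; lra. }
  assert (HR : Rabs (Re (Clog (p + h) - Clog p - h / p)) <= Cmod h ^ 2 / m ^ 2).
  { apply MVT_01_bound with
      (f := fun t => ln ((Re p + t * Re h) ^ 2 + (Im p + t * Im h) ^ 2) / 2 - t * Re (h / p))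
      (df := fun t => Re (h / (p + t * h) - h / p)).
    - unfold Clog, Re, Im; simpl.
      rewrite !Rmult_1_l, !Rmult_0_l, !Rplus_0_r; ring.
    - intros t Ht; assert (A := Hpos t Ht).
      destruct p as [p1 p2], h as [h1 h2]; simpl in *.
      assert (0 < (p1 + t * h1) ^ 2 + (p2 + t * h2) ^ 2).
      { apply sum_sqr_pos; left; lra. }
      assert (0 < p1 ^ 2 + p2 ^ 2) by (apply sum_sqr_pos; left; lra).
      auto_derive; [simpl in *; lra |].
      field; simpl in *; repeat split; try lra; intros E; ring_simplify in E; nra.
    - intros t Ht; eapply Rle_trans; [apply re_le_Cmod | now apply Hb]. }
  assert (HI : Rabs (Im (Clog (p + h) - Clog p - h / p)) <= Cmod h ^ 2 / m ^ 2).
  { apply MVT_01_bound with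
      (f := fun t => atan ((Im p + t * Im h) / (Re p + t * Re h)) - t * Im (h / p))
      (df := fun t => Im (h / (p + t * h) - h / p)).
    - unfold Clog, Re, Im; simpl.
      rewrite !Rmult_1_l, !Rmult_0_l, !Rplus_0_r; ring.
    - intros t Ht; assert (A := Hpos t Ht).
      destruct p as [p1 p2], h as [h1 h2]; simpl in *.
      assert (0 < (p1 + t * h1) ^ 2 + (p2 + t * h2) ^ 2).
      { apply sum_sqr_pos; left; lra. }
      assert (0 < p1 ^ 2 + p2 ^ 2) by (apply sum_sqr_pos; left; lra).
      auto_derive; [simpl in *; lra |].
      field; simpl in *; repeat split; try lra; intros E; ring_simplify in E; nra.
    - intros t Ht; eapply Rle_trans; [apply im_le_Cmod | now apply Hb]. }
  eapply Rle_trans; [apply Cmod_le_parts |]; lra.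
Qed.

(** * Convergence of Euler's limit in logarithmic form *)

Lemma ln_le_sub (x : R) : 0 < x -> ln x <= x - 1.
Proof.
  intros Hx; assert (H := exp_ineq1_le (ln x)); rewrite exp_ln in H by easy; lra.
Qed.

(** The logarithm of (n + 1) / n lies between 1 / (n + 1) and 1 / n. *)
Lemma ln_succ_bound (n : R) : 1 <= n -> Rabs (ln (n + 1) - ln n - / (n + 1)) <= / (n * (n + 1)).
Proof.
  intros Hn; rewrite <- ln_div by lra.
  assert (H1 := ln_le_sub ((n + 1) / n) ltac:(apply Rdiv_lt_0_compat; lra)).
  assert (H2 := ln_le_sub (n / (n + 1)) ltac:(apply Rdiv_lt_0_compat; lra)).
  rewrite ln_div in H1 |- * by lra; rewrite ln_div in H2 by lra.
  replace ((n + 1) / n - 1) with (/ n) in H1 by (field; lra).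
  replace (n / (n + 1) - 1) with (- / (n + 1)) in H2 by (field; lra).
  replace (/ (n * (n + 1))) with (/ n - / (n + 1)) by (field; lra).
  apply Rabs_le; lra.
Qed.

(** K / (n (n + 1)) telescopes, so the tail after n is at most K / n. *)
Lemma ex_lim_of_increments (u : nat -> R) (K : R) :
  (forall n, (1 <= n)%nat -> Rabs (u (S n) - u n) <= K / (INR n * (INR n + 1))) ->
  ex_finite_lim_seq u.
Proof.
  intros H; apply ex_lim_seq_cauchy_corr.
  assert (HK : 0 <= K).
  { specialize (H 1%nat (le_n _)); simpl in H; assert (H' := Rabs_pos (u 2%nat - u 1%nat)); lra. }
  assert (Hk : forall n k, (1 <= n)%nat -> Rabs (u (n + k)%nat - u n) <= K * (/ INR n - / INR (n + k))).
  { intros n k Hn; induction k as [| k IH].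
    - rewrite Nat.add_0_r, !Rminus_diag, Rabs_R0; lra.
    - rewrite Nat.add_succ_r.
      replace (u (S (n + k)) - u n) with ((u (S (n + k)) - u (n + k)%nat) + (u (n + k)%nat - u n)) by ring.
      eapply Rle_trans; [apply Rabs_triang |].
      specialize (H (n + k)%nat ltac:(lia)).
      assert (0 < INR (n + k)) by (apply lt_0_INR; lia).
      rewrite S_INR.
      replace (K / (INR (n + k) * (INR (n + k) + 1)))
        with (K * (/ INR (n + k) - / (INR (n + k) + 1))) in H by (field; lra).
      lra. }
  intros eps.
  destruct (nfloor_ex (K / eps)) as [N [_ HN]].
  { apply Rle_div_r; [apply eps | lra]. }
  assert (HN' : K * / INR (S N) < eps).
  { rewrite S_INR; apply Rmult_lt_reg_r with (INR N + 1); [assert (HH := pos_INR N); lra |].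
    rewrite Rmult_assoc, Rinv_l, Rmult_1_r by (assert (HH := pos_INR N); lra).
    apply Rmult_lt_compat_r with (r := eps) in HN; [| apply eps].
    unfold Rdiv in HN; rewrite Rmult_assoc, Rinv_l in HN by (apply Rgt_not_eq, eps); lra. }
  assert (Hw : forall n k, (S N <= n)%nat -> Rabs (u (n + k)%nat - u n) < eps).
  { intros n k Hn; eapply Rle_lt_trans; [apply Hk; lia |].
    eapply Rle_lt_trans; [| exact HN'].
    apply Rmult_le_compat_l; auto.
    assert (/ INR n <= / INR (S N)).
    { apply Rinv_le_contravar; [apply lt_0_INR; lia | now apply le_INR]. }
    assert (0 < / INR (n + k)) by (apply Rinv_0_lt_compat, lt_0_INR; lia); lra. }
  exists (S N); intros n m Hn Hm.
  destruct (Nat.le_ge_cases n m) as [L | L].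
  - rewrite Rabs_minus_sym; replace m with (n + (m - n))%nat by lia; auto.
  - replace n with (m + (n - m))%nat by lia; auto.
Qed.

(** For x > 0, [rho_seq] is the logarithm of the modulus of [Gamma_seq] and [lam_seq] its argument.
    Adding the arctangents of the factors, instead of taking the argument of the product, yields a
    branch continuous in x and y. *)
Definition rho_seq (x y : R) (n : nat) : R :=
  ln (INR (fact n)) + x * ln (INR n)
  - sum_f_R0 (fun k => ln ((x + INR k) ^ 2 + y ^ 2) / 2) n.

Definition lam_seq (x y : R) (n : nat) : R :=
  y * ln (INR n) - sum_f_R0 (fun k => atan (y / (x + INR k))) n.

Definition rho (x y : R) : R := real (Lim_seq (rho_seq x y)).
Definition lam (x y : R) : R := real (Lim_seq (lam_seq x y)).

Lemma fact_succ_ln (n : nat) : ln (INR (fact (S n))) = ln (INR n + 1) + ln (INR (fact n)).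
Proof.
  change (fact (S n)) with (S n * fact n)%nat; rewrite mult_INR, S_INR.
  apply ln_mult; [assert (H := pos_INR n); lra | apply lt_0_INR, lt_O_fact].
Qed.

(** With N = n + 1 the increment is z (ln N - ln n - 1 / N) minus the Taylor remainder of log(N + z)
    at N, both O(1 / n^2). One complex number holds both sequences, so that one estimate serves for
    both. *)
Lemma log_gamma_increment (x y : R) (n : nat) :
  0 < x -> (1 <= n)%nat ->
  Cmod (rho_seq x y (S n) - rho_seq x y n, lam_seq x y (S n) - lam_seq x y n)
    <= (2 * Cmod (x, y) ^ 2 + Cmod (x, y)) / (INR n * (INR n + 1)).
Proof.
  intros Hx Hn.
  assert (Hn' : 1 <= INR n) by now apply (le_INR 1).
  set (z := (x, y)); set (N := INR n + 1).
  assert (HN : N <> 0) by (unfold N; lra).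
  replace (_, _) with
    (z * RtoC (ln N - ln (INR n) - / N) - (Clog (N + z) - Clog N - z / N))%C.
  - eapply Rle_trans; [apply Cmod_triangle |].
    rewrite Cmod_opp, Cmod_mult, Cmod_R.
    assert (H1 := ln_succ_bound _ Hn'); fold N in H1.
    assert (H2 := Clog_quadratic N z N ltac:(unfold N; lra)
      ltac:(simpl; lra) ltac:(simpl; lra)).
    assert (Hz := Cmod_ge_0 z).
    assert (Cmod z * Rabs (ln N - ln (INR n) - / N) <= Cmod z * / (INR n * N))
      by now apply Rmult_le_compat_l.
    assert (2 * Cmod z ^ 2 / N ^ 2 <= 2 * Cmod z ^ 2 / (INR n * N)).
    { apply Rmult_le_compat_l; [assert (HH := pow2_ge_0 (Cmod z)); lra |].
      apply Rinv_le_contravar; unfold N; nra. }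
    rewrite Rdiv_plus_distr; unfold Rdiv in *; lra.
  - assert (Hl : ln (N ^ 2 + 0 ^ 2) / 2 = ln N).
    { replace (N ^ 2 + 0 ^ 2) with (N * N) by ring.
      rewrite ln_mult by (unfold N; lra); field. }
    unfold rho_seq, lam_seq, z; rewrite !tech5, fact_succ_ln, S_INR; fold N.
    apply C_eq_parts; unfold Clog.
    + simpl Re. unfold Clog; simpl. simpl in Hl. rewrite Hl.
      replace (0 + y) with y by ring. rewrite (Rplus_comm N x). field; auto.
    + unfold Clog; simpl.
      replace (0 / N) with 0 by (field; auto); rewrite atan_0.
      replace (0 + y) with y by ring. rewrite (Rplus_comm N x). field; auto.
Qed.

Lemma rho_lim (x y : R) : 0 < x -> is_lim_seq (rho_seq x y) (rho x y).
Proof.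
  intros Hx; apply Lim_seq_correct', (ex_lim_of_increments _ (2 * Cmod (x, y) ^ 2 + Cmod (x, y))).
  intros n Hn; eapply Rle_trans; [| now apply log_gamma_increment].
  exact (re_le_Cmod (_, _)).
Qed.

Lemma lam_lim (x y : R) : 0 < x -> is_lim_seq (lam_seq x y) (lam x y).
Proof.
  intros Hx; apply Lim_seq_correct', (ex_lim_of_increments _ (2 * Cmod (x, y) ^ 2 + Cmod (x, y))).
  intros n Hn; eapply Rle_trans; [| now apply log_gamma_increment].
  exact (im_le_Cmod (_, _)).
Qed.

Definition lgam (z : C) : C := (rho (Re z) (Im z), lam (Re z) (Im z)).

Lemma Crising_Cexp (x y : R) (n : nat) : 0 < x ->
  Crising (x, y) n = Cexp (sum_f_R0 (fun k => ln ((x + INR k) ^ 2 + y ^ 2) / 2) n,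
                           sum_f_R0 (fun k => atan (y / (x + INR k))) n).
Proof.
  intros Hx.
  assert (Hk : forall k, ((x, y) + INR k)%C
     = Cexp (ln ((x + INR k) ^ 2 + y ^ 2) / 2, atan (y / (x + INR k)))).
  { intros k; assert (H := pos_INR k).
    replace ((x, y) + INR k)%C with ((x + INR k, y) : C)
      by (apply C_eq_parts; simpl; ring).
    symmetry; apply (Cexp_Clog (x + INR k, y)); simpl; lra. }
  induction n as [| n IH].
  - transitivity ((x, y) + INR 0)%C; [apply C_eq_parts; simpl; ring | apply (Hk 0%nat)].
  - rewrite !tech5.
    change (Crising (x, y) (S n)) with (Crising (x, y) n * ((x, y) + INR (S n)))%C.
    now rewrite IH, Hk, <- Cexp_add.
Qed.

Lemma Gamma_seq_Cexp (x y : R) (n : nat) : 0 < x ->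
  Gamma_seq (x, y) n = Cexp (rho_seq x y n, lam_seq x y n).
Proof.
  intros Hx; unfold Gamma_seq; rewrite Crising_Cexp by easy.
  set (S1 := sum_f_R0 _ n); set (S2 := sum_f_R0 _ n).
  assert (E : RtoC (INR (fact n)) = Cexp (RtoC (ln (INR (fact n))))).
  { unfold Cexp; simpl; rewrite cos_0, sin_0, exp_ln by apply lt_0_INR, lt_O_fact.
    apply C_eq_parts; simpl; ring. }
  rewrite E, <- Cexp_add.
  set (w := (ln _ + _)%C).
  (* The same [ln (INR n)] stands on both sides, so n = 0 is no exception. *)
  replace w with (((S1, S2) : C) + ((rho_seq x y n, lam_seq x y n) : C))%C.
  - rewrite Cexp_add; field; apply Cexp_neq_0.
  - unfold w, rho_seq, lam_seq; fold S1 S2; apply C_eq_parts; simpl; ring.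
Qed.

Definition is_lim_C (u : nat -> C) (l : C) : Prop :=
  is_lim_seq (fun n => Re (u n)) (Re l) /\ is_lim_seq (fun n => Im (u n)) (Im l).

Lemma is_lim_C_mult (u v : nat -> C) (a b : C) :
  is_lim_C u a -> is_lim_C v b -> is_lim_C (fun n => u n * v n)%C (a * b)%C.
Proof.
  intros [H1 H2] [H3 H4]; split; simpl.
  - apply is_lim_seq_minus'; now apply is_lim_seq_mult'.
  - apply is_lim_seq_plus'; now apply is_lim_seq_mult'.
Qed.

Lemma CGamma_unique (z l : C) : is_lim_C (Gamma_seq z) l -> CGamma z = l.
Proof.
  intros [H1 H2]; apply is_lim_seq_unique in H1, H2.
  unfold CGamma; rewrite H1, H2; now destruct l.
Qed.

Lemma Gamma_seq_lim (z : C) : 0 < Re z -> is_lim_C (Gamma_seq z) (Cexp (lgam z)).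
Proof.
  destruct z as [x y]; simpl; intros Hx.
  assert (H1 := rho_lim x y Hx); assert (H2 := lam_lim x y Hx).
  assert (He : is_lim_seq (fun n => exp (rho_seq x y n)) (exp (rho x y))).
  { apply (is_lim_seq_continuous exp); auto; apply derivable_continuous_pt, derivable_pt_exp. }
  split; (eapply is_lim_seq_ext; [intros n; rewrite Gamma_seq_Cexp by easy; reflexivity |]);
    simpl; apply is_lim_seq_mult'; auto.
  - now apply (is_lim_seq_continuous cos); auto; apply continuity_cos.
  - now apply (is_lim_seq_continuous sin); auto; apply continuity_sin.
Qed.

Lemma CGamma_lgam (z : C) : 0 < Re z -> CGamma z = Cexp (lgam z).
Proof. intros H; now apply CGamma_unique, Gamma_seq_lim. Qed.

(** * The functional equation *)

Lemma is_lim_seq_unique_R (u : nat -> R) (a b : R) : is_lim_seq u a -> is_lim_seq u b -> a = b.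
Proof.
  intros H1 H2; apply is_lim_seq_unique in H1, H2; rewrite H1 in H2.
  now apply Rbar_finite_eq.
Qed.

Lemma is_lim_seq_c_over_n (c : R) : is_lim_seq (fun n => c / INR n) 0.
Proof.
  replace (Finite 0) with (Rbar_mult c 0) by (simpl; f_equal; ring).
  apply (is_lim_seq_scal_l (fun n => / INR n) c 0).
  replace (Finite 0) with (Rbar_inv p_infty) by reflexivity.
  apply is_lim_seq_inv; [apply is_lim_seq_INR | easy].
Qed.

Lemma is_lim_seq_affine (a c : R) : is_lim_seq (fun n => a + c / INR n) a.
Proof.
  replace (Finite a) with (Finite (a + 0)) by (f_equal; ring).
  apply is_lim_seq_plus'; [apply is_lim_seq_const | apply is_lim_seq_c_over_n].
Qed.

Lemma is_lim_seq_Rabs_le (u : nat -> R) (l c : R) :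
  (forall n, (1 <= n)%nat -> Rabs (u n - l) <= c / INR n) -> is_lim_seq u l.
Proof.
  intros H.
  apply is_lim_seq_le_le_loc with (u := fun n => l - c / INR n) (w := fun n => l + c / INR n).
  - exists 1%nat; intros n Hn; specialize (H n Hn); apply Rabs_le_between in H; lra.
  - replace l with (l - 0) at 1 by ring.
    apply is_lim_seq_minus'; [apply is_lim_seq_const | apply is_lim_seq_c_over_n].
  - replace l with (l + 0) at 1 by ring.
    apply is_lim_seq_plus'; [apply is_lim_seq_const | apply is_lim_seq_c_over_n].
Qed.

(** This is the end term left over when the factors of Euler's product are shifted by one. *)
Lemma Clog_asymptotic (x y : R) (n : nat) : 0 <= x -> (1 <= n)%nat ->
  Cmod (ln ((x + INR n) ^ 2 + y ^ 2) / 2 - ln (INR n), atan (y / (x + INR n)))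
    <= (Cmod (x, y) + 2 * Cmod (x, y) ^ 2) / INR n.
Proof.
  intros Hx Hn; assert (Hn' : 1 <= INR n) by now apply (le_INR 1).
  set (z := (x, y)); set (N := INR n) in *.
  assert (HN : N <> 0) by lra.
  replace (_, _) with ((Clog (N + z) - Clog N - z / N) + z / N)%C.
  - eapply Rle_trans; [apply Cmod_triangle |].
    assert (H2 := Clog_quadratic N z N ltac:(lra) ltac:(simpl; lra) ltac:(simpl; lra)).
    rewrite Cmod_div, Cmod_R, (Rabs_pos_eq N)
      by (try lra; intros E; apply HN; now injection E).
    assert (2 * Cmod z ^ 2 / N ^ 2 <= 2 * Cmod z ^ 2 / N).
    { apply Rmult_le_compat_l; [assert (HH := pow2_ge_0 (Cmod z)); lra |].
      apply Rinv_le_contravar; nra. }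
    rewrite Rdiv_plus_distr; unfold Rdiv in *; lra.
  - assert (Hl : ln (N ^ 2 + 0 ^ 2) / 2 = ln N).
    { replace (N ^ 2 + 0 ^ 2) with (N * N) by ring.
      rewrite ln_mult by lra; field. }
    simpl in Hl; unfold z; apply C_eq_parts; unfold Clog; simpl.
    + rewrite Hl; replace (0 + y) with y by ring; rewrite (Rplus_comm N x); field; auto.
    + replace (0 / N) with 0 by (field; auto); rewrite atan_0.
      replace (0 + y) with y by ring; rewrite (Rplus_comm N x); field; auto.
Qed.

Lemma rho_succ (x y : R) : 0 < x -> rho (x + 1) y = rho x y + ln (x ^ 2 + y ^ 2) / 2.
Proof.
  intros Hx.
  assert (H1 : is_lim_seq (rho_seq (x + 1) y) (rho x y + ln (x ^ 2 + y ^ 2) / 2 - 0)).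
  { apply is_lim_seq_ext with (fun n => rho_seq x y n + ln (x ^ 2 + y ^ 2) / 2
       - (ln ((x + 1 + INR n) ^ 2 + y ^ 2) / 2 - ln (INR n))).
    - intros n; unfold rho_seq.
      assert (E : sum_f_R0 (fun k => ln ((x + INR k) ^ 2 + y ^ 2) / 2) n
         + ln ((x + 1 + INR n) ^ 2 + y ^ 2) / 2
         = sum_f_R0 (fun k => ln ((x + 1 + INR k) ^ 2 + y ^ 2) / 2) n
         + ln (x ^ 2 + y ^ 2) / 2); [| lra].
      induction n as [| n IH].
      + cbv [sum_f_R0]; simpl INR; rewrite !Rplus_0_r; ring.
      + rewrite !tech5, S_INR in *.
        replace (x + (INR n + 1)) with (x + 1 + INR n) by ring; lra.
    - apply is_lim_seq_minus'; [apply is_lim_seq_plus';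
        [now apply rho_lim | apply is_lim_seq_const] |].
      apply is_lim_seq_Rabs_le with (Cmod (x + 1, y) + 2 * Cmod (x + 1, y) ^ 2).
      intros n Hn; rewrite Rminus_0_r.
      eapply Rle_trans; [| apply (Clog_asymptotic (x + 1) y n); [lra | auto]].
      exact (re_le_Cmod (_, _)). }
  assert (H2 := rho_lim (x + 1) y ltac:(lra)).
  assert (H3 := is_lim_seq_unique_R _ _ _ H1 H2); lra.
Qed.

(** Proved on the sums rather than deduced from the equation for [CGamma], which would leave a
    multiple of 2 pi undetermined. *)
Lemma lam_succ (x y : R) : 0 < x -> lam (x + 1) y = lam x y + atan (y / x).
Proof.
  intros Hx.
  assert (H1 : is_lim_seq (lam_seq (x + 1) y) (lam x y + atan (y / x) - 0)).
  { apply is_lim_seq_ext with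
      (fun n => lam_seq x y n + atan (y / x) - atan (y / (x + 1 + INR n))).
    - intros n; unfold lam_seq.
      assert (E : sum_f_R0 (fun k => atan (y / (x + INR k))) n + atan (y / (x + 1 + INR n))
         = sum_f_R0 (fun k => atan (y / (x + 1 + INR k))) n + atan (y / x)); [| lra].
      induction n as [| n IH].
      + cbv [sum_f_R0]; simpl INR; rewrite !Rplus_0_r; ring.
      + rewrite !tech5, S_INR in *.
        replace (x + (INR n + 1)) with (x + 1 + INR n) by ring; lra.
    - apply is_lim_seq_minus'; [apply is_lim_seq_plus';
        [now apply lam_lim | apply is_lim_seq_const] |].
      apply is_lim_seq_Rabs_le with (Cmod (x + 1, y) + 2 * Cmod (x + 1, y) ^ 2).
      intros n Hn; rewrite Rminus_0_r.
      eapply Rle_trans; [| apply (Clog_asymptotic (x + 1) y n); [lra | auto]].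
      exact (im_le_Cmod (_, _)). }
  assert (H2 := lam_lim (x + 1) y ltac:(lra)).
  assert (H3 := is_lim_seq_unique_R _ _ _ H1 H2); lra.
Qed.

Lemma Crising_succ (z : C) (n : nat) : (Crising z n * (z + INR n + 1) = z * Crising (z + 1) n)%C.
Proof.
  induction n as [| n IH].
  - simpl; ring.
  - change (Crising z (S n)) with (Crising z n * (z + INR (S n)))%C.
    change (Crising (z + 1) (S n)) with (Crising (z + 1) n * (z + 1 + INR (S n)))%C.
    rewrite S_INR, RtoC_plus.
    transitivity ((Crising z n * (z + INR n + 1)) * (z + 1 + (INR n + 1)))%C; [ring |].
    rewrite IH; ring.
Qed.

(** Reaches beyond the half-plane of [lgam], as Gamma(2 s - b) requires for Re b >= 2 s. The n-th
    term at z is the one at z + 1 times (z + n + 1) / (z n), which tends to 1 / z. *)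
Lemma CGamma_succ (z : C) : -1 < Re z -> z <> 0%C -> CGamma z = (CGamma (z + 1) / z)%C.
Proof.
  intros Hz Hz0.
  assert (Hp : 0 < Re (z + 1)) by (unfold Re in *; simpl; lra).
  rewrite (CGamma_lgam (z + 1)) by easy.
  apply CGamma_unique.
  assert (Hk : forall k, (z + INR k)%C <> 0%C).
  { intros [| k]; [simpl; intros E; apply Hz0; rewrite <- E; ring |].
    intros E; apply (f_equal Re) in E; rewrite S_INR in E; unfold Re in *; simpl in E.
    assert (H := pos_INR k); lra. }
  assert (Hr : forall n, Crising z n <> 0%C).
  { induction n as [| n IH].
    - intros E; now apply Hz0.
    - now apply Cmult_neq_0. }
  assert (Hl : is_lim_C (fun n => / z + (z + 1) / z * RtoC (/ INR n))%C (/ z)).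
  { split.
    - apply is_lim_seq_ext with (fun n => Re (/ z) + Re ((z + 1) / z) / INR n).
      + intros n; generalize ((z + 1) / z)%C; intros v; generalize (/ z)%C; intros u; unfold Rdiv, Re, Im; simpl; ring.
      + apply is_lim_seq_affine.
    - apply is_lim_seq_ext with (fun n => Im (/ z) + Im ((z + 1) / z) / INR n).
      + intros n; generalize ((z + 1) / z)%C; intros v; generalize (/ z)%C; intros u; unfold Rdiv, Re, Im; simpl; ring.
      + apply is_lim_seq_affine. }
  assert (Hm := is_lim_C_mult _ _ _ _ (Gamma_seq_lim (z + 1) Hp) Hl).
  assert (E : forall n, (1 <= n)%nat ->
    (Gamma_seq (z + 1) n * (/ z + (z + 1) / z * RtoC (/ INR n)))%C = Gamma_seq z n).
  { intros n Hn; unfold Gamma_seq.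
    assert (HN : 0 < INR n) by (apply lt_0_INR; lia).
    replace ((z + 1) * ln (INR n))%C with (z * ln (INR n) + ln (INR n))%C by ring.
    rewrite Cexp_add.
    replace (Cexp (RtoC (ln (INR n)))) with (RtoC (INR n))
      by (unfold Cexp; simpl; rewrite cos_0, sin_0, exp_ln by easy;
          apply C_eq_parts; simpl; ring).
    assert (Hn0 : RtoC (INR n) <> 0%C) by (intros E; injection E; lra).
    rewrite RtoC_inv by lra.
    replace (/ z + (z + 1) / z * / INR n)%C with ((z + INR n + 1) / (z * INR n))%C
      by (field; auto).
    assert (E := Crising_succ z n).
    assert (H1 : (z + INR n + 1)%C <> 0%C).
    { replace (z + INR n + 1)%C with (z + INR (S n))%C
        by (rewrite S_INR, RtoC_plus; ring); apply Hk. }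
    assert (H2 : Crising (z + 1) n <> 0%C).
    { intros E'; rewrite E' in E; apply (Cmult_neq_0 _ _ (Hr n) H1); rewrite E; ring. }
    replace (Crising z n) with (z * Crising (z + 1) n / (z + INR n + 1))%C
      by (rewrite <- E; field; auto).
    field; repeat split; auto. }
  destruct Hm as [Hm1 Hm2]; split.
  - eapply is_lim_seq_ext_loc; [| exact Hm1]; exists 1%nat; intros n Hn; now rewrite E.
  - eapply is_lim_seq_ext_loc; [| exact Hm2]; exists 1%nat; intros n Hn; now rewrite E.
Qed.

(** * Holomorphy of log Gamma *)

(** The derivative in z of the logarithm of [Gamma_seq z n]; its limit is the digamma function. *)
Definition psi_seq (z : C) (n : nat) : C :=
  (ln (INR n) - sum_f_R0 (fun k => Re (/ (z + INR k))) n,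
   - sum_f_R0 (fun k => Im (/ (z + INR k))) n).

Lemma psi_seq_lim (z : C) : 0 < Re z -> exists l, is_lim_C (psi_seq z) l.
Proof.
  intros Hz.
  assert (H : forall n, (1 <= n)%nat ->
    Cmod (psi_seq z (S n) - psi_seq z n) <= (1 + Cmod z) / (INR n * (INR n + 1))).
  { intros n Hn.
    assert (Hn' : 1 <= INR n) by now apply (le_INR 1).
    set (N := INR n + 1); assert (HN : 1 < N) by (unfold N; lra).
    assert (HN0 : RtoC N <> 0%C) by (intros E; injection E; lra).
    assert (Hge : N <= Cmod (z + N)).
    { eapply Rle_trans; [| apply re_le_Cmod]; unfold Re in *; simpl.
      eapply Rle_trans; [| apply Rle_abs]; lra. }
    assert (Hz0 : (z + N)%C <> 0%C) by (apply Cmod_gt_0; lra).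
    replace (psi_seq z (S n) - psi_seq z n)%C
      with (RtoC (ln N - ln (INR n) - / N) + z / (N * (z + N)))%C.
    - eapply Rle_trans; [apply Cmod_triangle |].
      assert (H1 := ln_succ_bound _ Hn'); fold N in H1.
      rewrite Cmod_R, Cmod_div, Cmod_mult, Cmod_R, (Rabs_pos_eq N)
        by (try lra; now apply Cmult_neq_0).
      assert (Cmod z / (N * Cmod (z + N)) <= Cmod z / (INR n * N)).
      { apply Rmult_le_compat_l; [apply Cmod_ge_0 |].
        apply Rinv_le_contravar; unfold N in *; nra. }
      rewrite Rdiv_plus_distr; unfold Rdiv in *; lra.
    - replace (z / (N * (z + N)))%C with (/ N - / (z + N))%C by (field; auto).
      rewrite <- RtoC_inv by lra.
      unfold psi_seq; rewrite !tech5, !S_INR; fold N.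
      apply C_eq_parts; simpl; ring. }
  assert (HR : ex_finite_lim_seq (fun n => Re (psi_seq z n))).
  { apply (ex_lim_of_increments _ (1 + Cmod z)); intros n Hn.
    eapply Rle_trans; [| now apply H]; exact (re_le_Cmod (_ - _)). }
  assert (HI : ex_finite_lim_seq (fun n => Im (psi_seq z n))).
  { apply (ex_lim_of_increments _ (1 + Cmod z)); intros n Hn.
    eapply Rle_trans; [| now apply H]; exact (im_le_Cmod (_ - _)). }
  destruct HR as [a Ha], HI as [b Hb]; exists (a, b); now split.
Qed.

(** The terms with k >= 1 are majorized by 2 / (k (k + 1)), which telescopes; the extra - 2 / (n +
    1) makes the induction work. *)
Lemma sum_inv_sqr_bound (x : R) (n : nat) : 0 < x ->
  sum_f_R0 (fun k => / (x + INR k) ^ 2) n <= / x ^ 2 + 2.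
Proof.
  intros Hx.
  enough (H : sum_f_R0 (fun k => / (x + INR k) ^ 2) n <= / x ^ 2 + 2 - 2 / (INR n + 1)).
  { assert (H1 := pos_INR n); assert (0 < 2 / (INR n + 1)) by (apply Rdiv_lt_0_compat; lra); lra. }
  induction n as [| n IH].
  - simpl; rewrite Rplus_0_r; lra.
  - rewrite tech5, S_INR; assert (H1 := pos_INR n).
    assert (/ (x + (INR n + 1)) ^ 2 <= 2 / (INR n + 1) - 2 / (INR n + 1 + 1)); [| lra].
    replace (2 / (INR n + 1) - 2 / (INR n + 1 + 1))
      with (/ ((INR n + 1) * (INR n + 1 + 1) / 2)) by (field; lra).
    apply Rinv_le_contravar; nra.
Qed.

(* The Taylor bound is uniform in [n], so that it survives the limit and yields
   the holomorphy of log Gamma without uniform convergence arguments. *)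
Lemma log_gamma_seq_quadratic (z h : C) (n : nat) :
  0 < Re z -> Cmod h < Re z / 2 ->
  let L := fun w => (rho_seq (Re w) (Im w) n, lam_seq (Re w) (Im w) n) in
  Cmod (L (z + h) - L z - h * psi_seq z n)%C
    <= 4 * (/ (Re z / 2) ^ 2 + 2) * Cmod h ^ 2.
Proof.
  intros Hz Hh L.
  set (q := fun k => (Clog ((z + INR k) + h) - Clog (z + INR k) - h / (z + INR k))%C).
  assert (E : (L (z + h) - L z - h * psi_seq z n)%C
    = (- sum_f_R0 (fun k => Re (q k)) n, - sum_f_R0 (fun k => Im (q k)) n)).
  { unfold L, rho_seq, lam_seq, psi_seq; set (l := ln (INR n)); set (f := ln (INR (fact n))).
    clearbody l f.
    assert (E1 : forall k, Re (q k) = ln ((Re (z + h) + INR k) ^ 2 + Im (z + h) ^ 2) / 2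
      - ln ((Re z + INR k) ^ 2 + Im z ^ 2) / 2
      - (Re h * Re (/ (z + INR k)) - Im h * Im (/ (z + INR k)))).
    { intros k; unfold q, Clog; simpl; rewrite !Rplus_0_r.
      now replace (fst z + INR k + fst h) with (fst z + fst h + INR k) by ring. }
    assert (E2 : forall k, Im (q k) = atan (Im (z + h) / (Re (z + h) + INR k))
      - atan (Im z / (Re z + INR k))
      - (Re h * Im (/ (z + INR k)) + Im h * Re (/ (z + INR k)))).
    { intros k; unfold q, Clog; simpl; rewrite !Rplus_0_r.
      now replace (fst z + INR k + fst h) with (fst z + fst h + INR k) by ring. }
    assert (S1 : forall a b c d e : nat -> R, forall u v,
      (forall k, a k = b k - c k - (u * d k + v * e k)) ->
      sum_f_R0 a n = sum_f_R0 b n - sum_f_R0 c n - (u * sum_f_R0 d n + v * sum_f_R0 e n)).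
    { intros a b c d e u v H; induction n as [| m IH]; [apply H |].
      rewrite !tech5, IH, H; ring. }
    apply C_eq_parts.
    - rewrite (S1 (fun k => Re (q k)) (fun k => ln ((Re (z + h) + INR k) ^ 2 + Im (z + h) ^ 2) / 2)
        (fun k => ln ((Re z + INR k) ^ 2 + Im z ^ 2) / 2) (fun k => Re (/ (z + INR k)))
        (fun k => Im (/ (z + INR k))) (Re h) (- Im h)) by (intros k; rewrite E1; ring).
      repeat match goal with |- context [sum_f_R0 ?f n] => generalize (sum_f_R0 f n); intro end.
      unfold Re, Im; simpl; ring.
    - rewrite (S1 (fun k => Im (q k)) (fun k => atan (Im (z + h) / (Re (z + h) + INR k)))
        (fun k => atan (Im z / (Re z + INR k))) (fun k => Im (/ (z + INR k)))
        (fun k => Re (/ (z + INR k))) (Re h) (Im h)) by (intros k; rewrite E2; ring).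
      repeat match goal with |- context [sum_f_R0 ?f n] => generalize (sum_f_R0 f n); intro end.
      unfold Re, Im; simpl; ring. }
  (* |h| < Re z / 2 keeps both end points to the right of Re z / 2 + k, which makes the remainders
     summable uniformly in n. *)
  assert (Hq : forall k, Cmod (q k) <= 2 * Cmod h ^ 2 * / (Re z / 2 + INR k) ^ 2).
  { intros k; assert (Hk := pos_INR k); assert (H1 := re_le_Cmod h).
    assert (H2 := Rle_abs (- Re h)); rewrite Rabs_Ropp in H2.
    apply (Clog_quadratic _ _ (Re z / 2 + INR k)); unfold Re in *; simpl; lra. }
  rewrite E; eapply Rle_trans; [apply Cmod_le_parts |]; simpl; rewrite !Rabs_Ropp.
  assert (Hs := sum_inv_sqr_bound (Re z / 2) n ltac:(lra)).
  assert (Hh2 := pow2_ge_0 (Cmod h)).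
  assert (HR : forall g : C -> R, (forall w, Rabs (g w) <= Cmod w) ->
    Rabs (sum_f_R0 (fun k => g (q k)) n) <= 2 * Cmod h ^ 2 * (/ (Re z / 2) ^ 2 + 2)).
  { intros g Hg; eapply Rle_trans; [apply sum_f_R0_triangle |].
    apply Rle_trans with (2 * Cmod h ^ 2 * sum_f_R0 (fun k => / (Re z / 2 + INR k) ^ 2) n).
    - rewrite scal_sum; apply sum_Rle; intros k _; rewrite (Rmult_comm (/ _)).
      eapply Rle_trans; [apply Hg | apply Hq].
    - apply Rmult_le_compat_l; lra. }
  assert (H1 := HR Re re_le_Cmod); assert (H2 := HR Im im_le_Cmod); simpl in *; lra.
Qed.

Lemma is_lim_seq_le_const (u : nat -> R) (l B : R) :
  is_lim_seq u l -> (forall n, u n <= B) -> l <= B.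
Proof.
  intros Hu H; exact (is_lim_seq_le u (fun _ => B) l B H Hu (is_lim_seq_const B)).
Qed.

Lemma is_lim_seq_ge_const (u : nat -> R) (l B : R) :
  is_lim_seq u l -> (forall n, B <= u n) -> B <= l.
Proof.
  intros Hu H; exact (is_lim_seq_le (fun _ => B) u B l H (is_lim_seq_const B) Hu).
Qed.

Lemma is_lim_C_Cmod_le (u : nat -> C) (l : C) (B : R) :
  is_lim_C u l -> (forall n, Cmod (u n) <= B) -> Cmod l <= 2 * B.
Proof.
  intros [H1 H2] H.
  assert (Rabs (Re l) <= B).
  { apply (is_lim_seq_le_const (fun n => Rabs (Re (u n)))).
    - now apply (is_lim_seq_abs _ (Re l)).
    - intros n; eapply Rle_trans; [apply re_le_Cmod | apply H]. }
  assert (Rabs (Im l) <= B).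
  { apply (is_lim_seq_le_const (fun n => Rabs (Im (u n)))).
    - now apply (is_lim_seq_abs _ (Im l)).
    - intros n; eapply Rle_trans; [apply im_le_Cmod | apply H]. }
  assert (Hl := Cmod_le_parts l); lra.
Qed.

Lemma is_lim_C_minus (u v : nat -> C) (a b : C) :
  is_lim_C u a -> is_lim_C v b -> is_lim_C (fun n => u n - v n)%C (a - b)%C.
Proof.
  intros [H1 H2] [H3 H4]; split; simpl; now apply is_lim_seq_minus'.
Qed.

Lemma is_lim_C_const (a : C) : is_lim_C (fun _ => a) a.
Proof. split; apply is_lim_seq_const. Qed.

Lemma cdiff_lgam (z : C) : 0 < Re z -> cdiff lgam z.
Proof.
  intros Hz; destruct (psi_seq_lim z Hz) as [l Hl].
  apply (cdiff_quadratic _ _ l (Re z / 2) (2 * (4 * (/ (Re z / 2) ^ 2 + 2)))); [lra |].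
  intros h Hh; rewrite Rmult_assoc.
  assert (Hlog : forall w, 0 < Re w ->
    is_lim_C (fun n => (rho_seq (Re w) (Im w) n, lam_seq (Re w) (Im w) n)) (lgam w)).
  { intros w Hw; split; [now apply rho_lim | now apply lam_lim]. }
  assert (Hzh : 0 < Re (z + h)).
  { assert (H1 := re_le_Cmod h); assert (H2 := Rle_abs (- Re h)); rewrite Rabs_Ropp in H2.
    unfold Re in *; simpl; lra. }
  eapply is_lim_C_Cmod_le; [| intros n; now apply log_gamma_seq_quadratic].
  apply is_lim_C_minus; [apply is_lim_C_minus; now apply Hlog |].
  apply is_lim_C_mult; [apply is_lim_C_const | exact Hl].
Qed.

Lemma locally_Re_gt (a : R) (z : C) : a < Re z -> locally (T := C_UniformSpace) z (fun w => a < Re w).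
Proof.
  intros H; apply locally_C_disc; exists (Re z - a); split; [lra |].
  intros w Hw; assert (H1 := re_le_Cmod (w - z)).
  assert (H2 := Rle_abs (- Re (w - z))); rewrite Rabs_Ropp in H2.
  unfold Re in *; simpl in *; lra.
Qed.

Lemma locally_Re_lt (a : R) (z : C) : Re z < a -> locally (T := C_UniformSpace) z (fun w => Re w < a).
Proof.
  intros H; apply locally_C_disc; exists (a - Re z); split; [lra |].
  intros w Hw; assert (H1 := re_le_Cmod (w - z)).
  assert (H2 := Rle_abs (Re (w - z))).
  unfold Re in *; simpl in *; lra.
Qed.

Lemma cdiff_CGamma (z : C) : 0 < Re z -> cdiff CGamma z.
Proof.
  intros Hz; apply cdiff_ext_loc with (fun w => Cexp (lgam w)).
  - generalize (locally_Re_gt 0 z Hz); apply filter_imp; intros w Hw.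
    symmetry; now apply CGamma_lgam.
  - apply (cdiff_comp Cexp lgam); [apply cdiff_Cexp | now apply cdiff_lgam].
Qed.

Lemma CGamma_neq_0 (z : C) : 0 < Re z -> CGamma z <> 0%C.
Proof. intros Hz; rewrite CGamma_lgam by easy; apply Cexp_neq_0. Qed.

(** * Monotonicity and convexity of the modulus and argument of Gamma *)

Lemma rho_opp (x y : R) : rho x (- y) = rho x y.
Proof.
  unfold rho; f_equal; apply Lim_seq_ext; intros n; unfold rho_seq.
  now replace ((- y) ^ 2) with (y ^ 2) by ring.
Qed.

Lemma lam_opp (x y : R) : 0 < x -> lam x (- y) = - lam x y.
Proof.
  intros Hx; apply (is_lim_seq_unique_R (lam_seq x (- y))); [now apply lam_lim |].
  apply is_lim_seq_ext with (fun n => - lam_seq x y n).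
  - intros n; unfold lam_seq.
    rewrite (sum_eq (fun k => atan (- y / (x + INR k))) (fun k => atan (y / (x + INR k)) * (-1))).
    + rewrite <- scal_sum; ring.
    + intros k _; replace (- y / (x + INR k)) with (- (y / (x + INR k))) by (unfold Rdiv; ring).
      rewrite atan_opp; ring.
  - apply (is_lim_seq_opp _ (lam x y)); now apply lam_lim.
Qed.

Lemma lam_0 (x : R) : 0 < x -> lam x 0 = 0.
Proof. intros Hx; assert (H := lam_opp x 0 Hx); rewrite Ropp_0 in H; lra. Qed.

(** Every factor |x + k + i y| of the denominator grows with y. *)
Lemma rho_decr (x y y' : R) : 0 < x -> 0 <= y <= y' -> rho x y' <= rho x y.
Proof.
  intros Hx Hy.
  apply (is_lim_seq_le (rho_seq x y') (rho_seq x y) (rho x y') (rho x y));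
    [| now apply rho_lim | now apply rho_lim].
  intros n; unfold rho_seq.
  enough (sum_f_R0 (fun k => ln ((x + INR k) ^ 2 + y ^ 2) / 2) n
    <= sum_f_R0 (fun k => ln ((x + INR k) ^ 2 + y' ^ 2) / 2) n) by lra.
  apply sum_Rle; intros k _; assert (Hk := pos_INR k).
  assert (H : 0 < (x + INR k) ^ 2) by (apply pow_lt; lra).
  assert (ln ((x + INR k) ^ 2 + y ^ 2) <= ln ((x + INR k) ^ 2 + y' ^ 2)); [| lra].
  apply ln_le; nra.
Qed.

Lemma ln_sqr_half (u : R) : 0 < u -> ln (u ^ 2 + 0 ^ 2) / 2 = ln u.
Proof.
  intros Hu; replace (u ^ 2 + 0 ^ 2) with (u * u) by ring; rewrite ln_mult by easy; field.
Qed.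

Lemma sum_f_R0_ge_first (f : nat -> R) (n : nat) :
  (forall k, 0 <= f k) -> f 0%nat <= sum_f_R0 f n.
Proof.
  intros H; induction n as [| n IH]; [simpl; lra |].
  rewrite tech5; specialize (H (S n)); lra.
Qed.

(* With [a + b = a' + b'], the inequality [a b <= a' b'] propagates to all the
   factors [(a + k) (b + k)]; the factor [k = 0] is kept as an explicit gain. *)
Lemma rho_convex (a b a' b' : R) :
  0 < a -> 0 < b -> 0 < a' -> 0 < b' -> a + b = a' + b' -> a * b <= a' * b' ->
  rho a' 0 + rho b' 0 + (ln (a' * b') - ln (a * b)) <= rho a 0 + rho b 0.
Proof.
  intros Ha Hb Ha' Hb' Hs Hp.
  assert (H := is_lim_seq_minus' _ _ _ _
    (is_lim_seq_plus' _ _ _ _ (rho_lim a 0 Ha) (rho_lim b 0 Hb))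
    (is_lim_seq_plus' _ _ _ _ (rho_lim a' 0 Ha') (rho_lim b' 0 Hb'))).
  apply is_lim_seq_ge_const with (B := ln (a' * b') - ln (a * b)) in H; [lra |].
  intros n; unfold rho_seq.
  set (T := fun x k => ln ((x + INR k) ^ 2 + 0 ^ 2) / 2).
  assert (E : forall x, 0 < x -> forall k, T x k = ln (x + INR k)).
  { intros x Hx k; apply ln_sqr_half; assert (Hk := pos_INR k); lra. }
  fold (T a) (T b) (T a') (T b').
  assert (Hk : forall k, 0 <= T a' k + T b' k - (T a k + T b k)).
  { intros k; rewrite !E by easy; assert (Hk := pos_INR k).
    rewrite <- !ln_mult by lra.
    assert (ln ((a + INR k) * (b + INR k)) <= ln ((a' + INR k) * (b' + INR k)))
      by (apply ln_le; nra).
    lra. }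
  assert (H1 := sum_f_R0_ge_first _ n Hk).
  rewrite minus_sum, !plus_sum in H1.
  rewrite !E in H1 by easy; simpl INR in H1; rewrite !Rplus_0_r in H1.
  rewrite !ln_mult by easy.
  replace (b * ln (INR n)) with ((a' + b' - a) * ln (INR n)) by (rewrite <- Hs; ring).
  lra.
Qed.

Lemma atan_le (x y : R) : x <= y -> atan x <= atan y.
Proof. intros [H | ->]; [left; now apply atan_increasing | lra]. Qed.

Lemma Rdiv_le_contravar (y a b : R) : 0 <= y -> 0 < b <= a -> y / a <= y / b.
Proof. intros Hy Hb; apply Rmult_le_compat_l; auto; apply Rinv_le_contravar; lra. Qed.

Lemma Rdiv_lt_contravar (y a b : R) : 0 < y -> 0 < b < a -> y / a < y / b.
Proof. intros Hy Hb; apply Rmult_lt_compat_l; auto; apply Rinv_lt_contravar; nra. Qed.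

(** The terms y ln n cancel in the difference, leaving a series whose terms are nonnegative when b <
    a and y >= 0. *)
Lemma lam_diff_lim (a b y : R) : 0 < a -> 0 < b ->
  is_lim_seq (fun n => sum_f_R0 (fun k => atan (y / (b + INR k)) - atan (y / (a + INR k))) n)
    (lam a y - lam b y).
Proof.
  intros Ha Hb.
  apply is_lim_seq_ext with (fun n => lam_seq a y n - lam_seq b y n).
  - intros n; unfold lam_seq; rewrite minus_sum; ring.
  - apply is_lim_seq_minus'; now apply lam_lim.
Qed.

(** The term k = 0 of the series is a fixed positive lower bound, which keeps the inequality strict
    in the limit. *)
Lemma lam_incr (a b y : R) : 0 < b < a -> 0 < y -> lam b y < lam a y.
Proof.
  intros Hb Hy.
  assert (H := lam_diff_lim a b y ltac:(lra) ltac:(lra)).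
  apply is_lim_seq_ge_const with (B := atan (y / b) - atan (y / a)) in H.
  - assert (H1 := atan_increasing _ _ (Rdiv_lt_contravar y a b Hy Hb)); lra.
  - intros n.
    eapply Rle_trans; [| apply (sum_f_R0_ge_first
      (fun k => atan (y / (b + INR k)) - atan (y / (a + INR k))))].
    + simpl; rewrite !Rplus_0_r; lra.
    + intros k; assert (Hk := pos_INR k).
      assert (H1 := atan_le _ _ (Rdiv_le_contravar y (a + INR k) (b + INR k)
        ltac:(lra) ltac:(lra))); lra.
Qed.

Lemma atan_MVT (u v : R) : u < v ->
  exists c, u <= c <= v /\ atan v - atan u = (v - u) / (1 + c ^ 2).
Proof.
  intros H.
  destruct (MVT_gen atan u v (fun t => / (1 + t ^ 2))) as [c [Hc E]].
  - intros x _; auto_derive; auto; unfold Rsqr; simpl; field.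
    assert (H' := pow2_ge_0 x); simpl in H'; lra.
  - intros x _; apply derivable_continuous_pt, derivable_pt_atan.
  - rewrite Rmin_left, Rmax_right in Hc by lra.
    exists c; split; auto; rewrite E; unfold Rdiv; ring.
Qed.

(* Comparison of [y / (t^2 + y^2)], a decreasing function of [t >= 0], with its
   integral: the sum over [t = b + k] is at most [PI / 2 - atan ((b - 1) / y)]. *)
Lemma lam_diff_le (a b y : R) : 1 <= b < a -> 0 < y ->
  lam a y - lam b y <= (a - b) * (PI / 2 - atan ((b - 1) / y)).
Proof.
  intros Hb Hy.
  assert (Ht : forall k, atan (y / (b + INR k)) - atan (y / (a + INR k))
    <= (a - b) * (atan ((b + INR k) / y) - atan ((b + INR k - 1) / y))).
  { intros k; assert (Hk := pos_INR k); set (B := b + INR k).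
    replace (a + INR k) with (B + (a - b)) by (unfold B; ring); set (d := a - b).
    assert (HB : 1 <= B) by (unfold B; lra); assert (Hd : 0 < d) by (unfold d; lra).
    assert (Hinv : forall t, 0 < t -> atan (y / t) = PI / 2 - atan (t / y)).
    { intros t Htp; rewrite <- atan_inv by (apply Rdiv_lt_0_compat; lra).
      f_equal; field; lra. }
    rewrite !Hinv by lra.
    destruct (atan_MVT (B / y) ((B + d) / y)) as [c [Hc Ec]].
    { apply Rmult_lt_compat_r; [now apply Rinv_0_lt_compat | lra]. }
    destruct (atan_MVT ((B - 1) / y) (B / y)) as [c' [Hc' Ec']].
    { apply Rmult_lt_compat_r; [now apply Rinv_0_lt_compat | lra]. }
    replace (PI / 2 - atan (B / y) - (PI / 2 - atan ((B + d) / y)))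
      with (atan ((B + d) / y) - atan (B / y)) by ring.
    rewrite Ec, Ec'.
    replace ((B + d) / y - B / y) with (d / y) by (field; lra).
    replace (B / y - (B - 1) / y) with (/ y) by (field; lra).
    replace (d * (/ y / (1 + c' ^ 2))) with (d / y / (1 + c' ^ 2)) by (unfold Rdiv; ring).
    apply Rdiv_le_contravar; [apply Rlt_le, Rdiv_lt_0_compat; lra |].
    assert (0 <= (B - 1) / y) by (apply Rmult_le_pos; [lra | left; now apply Rinv_0_lt_compat]).
    assert (0 <= c' <= c) by lra; nra. }
  apply (is_lim_seq_le_const _ _ _ (lam_diff_lim a b y ltac:(lra) ltac:(lra))).
  intros n.
  apply Rle_trans with ((a - b) * (atan ((b + INR n) / y) - atan ((b - 1) / y))).
  - induction n as [| n IH].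
    + specialize (Ht 0%nat); cbv [sum_f_R0]; simpl INR in *; rewrite !Rplus_0_r in *; exact Ht.
    + rewrite tech5; specialize (Ht (S n)); rewrite S_INR in *.
      replace (b + (INR n + 1) - 1) with (b + INR n) in Ht by ring; lra.
  - apply Rmult_le_compat_l; [lra |].
    assert (H := atan_bound ((b + INR n) / y)); lra.
Qed.

(** At b = 1 the bound of [lam_diff_le] is exactly (a - b) PI / 2. Halving the interval gains
    strictness, because its upper half starts at m > 1. *)
Lemma lam_diff_lt (a b y : R) : 1 <= b < a -> 0 < y -> lam a y - lam b y < (a - b) * (PI / 2).
Proof.
  intros Hb Hy; set (m := (a + b) / 2).
  assert (H1 := lam_diff_le a m y ltac:(unfold m; lra) Hy).
  assert (H2 := lam_diff_le m b y ltac:(unfold m; lra) Hy).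
  assert (Hm : 0 < (m - 1) / y) by (apply Rdiv_lt_0_compat; unfold m; lra).
  assert (Hm' : 0 <= (b - 1) / y)
    by (apply Rmult_le_pos; [lra | left; now apply Rinv_0_lt_compat]).
  apply atan_increasing in Hm; apply atan_le in Hm'; rewrite atan_0 in Hm, Hm'.
  assert (a - m = (a - b) / 2) by (unfold m; field).
  assert (m - b = (a - b) / 2) by (unfold m; field).
  rewrite H, H0 in *.
  assert (0 < (a - b) / 2) by lra.
  assert (0 < (a - b) / 2 * atan ((m - 1) / y)) by (apply Rmult_lt_0_compat; lra).
  assert (0 <= (a - b) / 2 * atan ((b - 1) / y)) by (apply Rmult_le_pos; lra).
  lra.
Qed.

(** * Reduction to the characteristic function *)

Lemma cosh_pos (y : R) : 0 < cosh y.
Proof. unfold cosh; assert (H := exp_pos y); assert (H' := exp_pos (- y)); lra. Qed.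

Lemma cosh_opp (y : R) : cosh (- y) = cosh y.
Proof. unfold cosh; rewrite Ropp_involutive; field. Qed.

Lemma sinh_opp (y : R) : sinh (- y) = - sinh y.
Proof. unfold sinh; rewrite Ropp_involutive; field. Qed.

Lemma sinh_incr (y y' : R) : y < y' -> sinh y < sinh y'.
Proof.
  intros H; unfold sinh; assert (H1 := exp_increasing _ _ H).
  assert (H2 := exp_increasing (- y') (- y) ltac:(lra)); lra.
Qed.

Lemma sinh_pos (y : R) : 0 < y -> 0 < sinh y.
Proof. intros H; rewrite <- sinh_0; now apply sinh_incr. Qed.

Lemma sinh_ge_id (y : R) : 0 <= y -> y <= sinh y.
Proof.
  intros Hy; destruct (MVT_gen (fun t => sinh t - t) 0 y (fun t => cosh t - 1)) as [c [Hc E]].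
  - intros x _; unfold sinh, cosh; auto_derive; auto; field.
  - intros x _; apply continuity_pt_minus; [| apply derivable_continuous_pt, derivable_pt_id].
    apply derivable_continuous_pt, derivable_pt_sinh.
  - rewrite sinh_0 in E.
    assert (H1 := exp_ineq1_le c); assert (H2 := exp_ineq1_le (- c)).
    assert (0 <= cosh c - 1) by (unfold cosh; lra); nra.
Qed.

Lemma cosh_sqr (y : R) : cosh y ^ 2 = 1 + sinh y ^ 2.
Proof.
  unfold cosh, sinh; assert (E : exp y * exp (- y) = 1)
    by (rewrite <- exp_plus, Rplus_opp_r; apply exp_0).
  assert (exp y ^ 2 + 2 * (exp y * exp (- y)) + exp (- y) ^ 2
    = 4 + (exp y ^ 2 - 2 * (exp y * exp (- y)) + exp (- y) ^ 2)) by (rewrite E; ring).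
  nra.
Qed.

Lemma sin_PI_pos (t : R) : 0 < t < 1 -> 0 < sin (PI * t).
Proof. intros H; assert (Hp := PI_RGT_0); apply sin_gt_0; nra. Qed.

Lemma cos_PI_pos (t : R) : - (1 / 2) < t < 1 / 2 -> 0 < cos (PI * t).
Proof. intros H; assert (Hp := PI_RGT_0); apply cos_gt_0; nra. Qed.

(** The real part sin(pi a) cosh(pi b) vanishes only for a = 0, and then the imaginary part is
    sinh(pi b). *)
Lemma Csin_neq_0 (a b : R) : -1 < a < 1 -> (a, b) <> (0, 0) -> Csin (PI * (a, b)%R) <> 0%C.
Proof.
  intros Ha Hab E; assert (Hp := PI_RGT_0).
  replace (PI * (a, b))%C with ((PI * a, PI * b) : C) in E
    by (apply C_eq_parts; simpl; ring).
  rewrite Csin_parts in E; injection E as E1 E2.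
  assert (Hc := cosh_pos (PI * b)).
  assert (a = 0).
  { destruct (Rtotal_order a 0) as [H | [H | H]]; auto; exfalso.
    - assert (H1 := sin_PI_pos (- a) ltac:(lra)).
      replace (PI * - a) with (- (PI * a)) in H1 by ring; rewrite sin_neg in H1; nra.
    - assert (H1 := sin_PI_pos a ltac:(lra)); nra. }
  subst a; rewrite Rmult_0_r, cos_0, Rmult_1_l in E2.
  apply Hab; f_equal.
  destruct (Rtotal_order b 0) as [H | [H | H]]; auto; exfalso.
  - assert (H1 := sinh_pos (PI * - b) ltac:(nra)).
    replace (PI * - b) with (- (PI * b)) in H1 by ring; rewrite sinh_opp in H1; lra.
  - assert (H1 := sinh_pos (PI * b) ltac:(nra)); lra.
Qed.

(* [f_s s] is [char_fun s] divided by [cofactor s], which has no zero in the strip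
   except at the pole [2 s]. *)
Definition char_fun (s : R) (b : C) : C :=
  (Csin (PI * (b - s)) * (b - 2 * s)
   - Csin (PI * s) / CGamma (2 * s) * (CGamma (2 * s + 1 - b) * CGamma (b + 1)))%C.

Definition cofactor (s : R) (b : C) : C :=
  (CGamma (b - 2 * s + 1) * Csin (PI * (b - 2 * s)) * (b - 2 * s) / CGamma (b + 1))%C.

(** Here, for s > 0, all arguments of [CGamma] in [char_fun] and [cofactor] have positive real part,
    and |x - 2 s| < 1 leaves 2 s as the only zero of sin(pi (b - 2 s)). *)
Definition strip (s x : R) : Prop := 0 < x /\ 2 * s - 1 < x < 2 * s + 1.

Lemma Csin_PI_shift_neq_0 (s : R) (b : C) :
  strip s (Re b) -> b <> (2 * s)%C -> Csin (PI * (b - 2 * s)) <> 0%C.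
Proof.
  intros [H1 H2] Hb.
  replace (b - 2 * s)%C with ((Re b - 2 * s, Im b) : C) by (apply C_eq_parts; unfold Re, Im; simpl; ring).
  apply Csin_neq_0; [lra |].
  intros E; injection E as E1 E2; apply Hb; apply C_eq_parts; unfold Re, Im in *; simpl; lra.
Qed.

Lemma f_s_char_fun (s : R) (b : C) : 0 < s < 1 -> strip s (Re b) -> b <> (2 * s)%C ->
  cofactor s b <> 0%C /\ f_s s b = (char_fun s b / cofactor s b)%C.
Proof.
  intros Hs Hb Hne; assert (H1 := Csin_PI_shift_neq_0 s b Hb Hne).
  destruct Hb as [Hb1 Hb2].
  assert (H2 : (b - 2 * s)%C <> 0%C).
  { intros E; apply Hne; replace b with (b - 2 * s + 2 * s)%C by ring; rewrite E; ring. }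
  assert (H3 : CGamma (b - 2 * s + 1) <> 0%C) by (apply CGamma_neq_0; unfold Re in *; simpl; lra).
  assert (H4 : CGamma (b + 1) <> 0%C) by (apply CGamma_neq_0; unfold Re in *; simpl; lra).
  assert (H5 : CGamma (2 * s) <> 0%C) by (apply CGamma_neq_0; unfold Re in *; simpl; lra).
  assert (H6 : Csin (PI * s) <> 0%C).
  { apply (Csin_neq_0 s 0); [lra |]; intros E; injection E; lra. }
  assert (H7 : (2 * s - b)%C <> 0%C).
  { intros E; apply H2; replace (b - 2 * s)%C with (- (2 * s - b))%C by ring; rewrite E; ring. }
  assert (H8 : (/ CGamma (b + 1))%C <> 0%C).
  { intros E; apply (Cmult_neq_0 _ _ H4 H4).
    replace (CGamma (b + 1)) with (CGamma (b + 1) * CGamma (b + 1) * / CGamma (b + 1))%C at 1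
      by (field; auto); rewrite E; ring. }
  split.
  - unfold cofactor; repeat (apply Cmult_neq_0; auto).
  - unfold f_s, char_fun, cofactor.
    (* The shift exposes the pole of Gamma(2 s - b) as a factor 1 / (2 s - b), which the factor b -
       2 s in [char_fun] and [cofactor] clears. *)
    rewrite (CGamma_succ (2 * s - b)%C) by (auto; unfold Re in *; simpl; lra).
    replace (2 * s - b + 1)%C with (2 * s + 1 - b)%C by ring.
    field; repeat split; auto.
Qed.

Lemma locally_strip (s : R) (b : C) : strip s (Re b) ->
  locally (T := C_UniformSpace) b (fun w => strip s (Re w)).
Proof.
  intros [H1 [H2 H3]].
  generalize (filter_and _ _ (locally_Re_gt _ _ H1)
    (filter_and _ _ (locally_Re_gt _ _ H2) (locally_Re_lt _ _ H3))).
  apply filter_imp; unfold strip; tauto.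
Qed.

Ltac cdiff_tac :=
  repeat match goal with
  | |- cdiff (fun _ => ?a) _ => apply cdiff_const
  | |- cdiff (fun w => w) _ => apply cdiff_id
  | |- cdiff (fun w => Csin _) _ => apply (cdiff_comp Csin); [apply cdiff_Csin |]
  | |- cdiff (fun w => CGamma _) _ => apply (cdiff_comp CGamma); [apply cdiff_CGamma |]
  | |- cdiff (fun w => Cinv _) _ => apply cdiff_inv; [| apply CGamma_neq_0]
  | |- cdiff (fun w => Cminus _ _) _ => apply cdiff_minus
  | |- cdiff (fun w => Cplus _ _) _ => apply cdiff_plus
  | |- cdiff (fun w => Cmult _ _) _ => apply cdiff_mult
  | |- cdiff (Cminus ?a) _ => apply (cdiff_minus (fun _ => a) (fun w => w))
  end; unfold Re in *; simpl; lra.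

Lemma cdiff_char_fun (s : R) (b : C) : 0 < s < 1 -> strip s (Re b) -> cdiff (char_fun s) b.
Proof. intros Hs [H1 H2]; unfold char_fun, Cdiv; cdiff_tac. Qed.

Lemma cdiff_cofactor (s : R) (b : C) : 0 < s < 1 -> strip s (Re b) -> cdiff (cofactor s) b.
Proof. intros Hs [H1 H2]; unfold cofactor, Cdiv; cdiff_tac. Qed.

Lemma locally_neq (a z : C) : z <> a -> locally (T := C_UniformSpace) z (fun w => w <> a).
Proof.
  intros H.
  assert (H1 := continuous_C_neq_0 (fun w => w - a)%C z
    (cdiff_continuous _ _ (cdiff_minus _ _ _ (cdiff_id z) (cdiff_const a z)))).
  simpl in H1; generalize (H1 ltac:(intros E; apply H;
    replace z with (z - a + a)%C by ring; rewrite E; ring)).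
  apply filter_imp; intros w Hw E; apply Hw; rewrite E; ring.
Qed.

(** With g the holomorphic extension, [char_fun s] equals g times [cofactor s] on a punctured
    neighbourhood of b, hence at b by continuity. This covers b = 2 s as well. *)
Lemma meromorphic_zero_char_fun (s : R) (b : C) :
  0 < s < 1 -> strip s (Re b) -> meromorphic_zero (f_s s) b -> char_fun s b = 0%C.
Proof.
  intros Hs Hb [g [Hg [Hgf Hg0]]].
  assert (Hc : continuous (T := C_UniformSpace) (U := C_UniformSpace)
                 (fun w => char_fun s w - g w * cofactor s w)%C b).
  { apply continuous_Cplus; [now apply cdiff_continuous, cdiff_char_fun |].
    apply continuous_Copp, continuous_Cmult; [| now apply cdiff_continuous, cdiff_cofactor].
    apply ex_derive_C_continuous; exact (locally_singleton _ _ Hg). }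
  destruct (excluded_middle_informative (char_fun s b = 0%C)) as [E | E]; auto; exfalso.
  assert (H := continuous_C_neq_0 _ _ Hc).
  simpl in H; rewrite Hg0 in H.
  specialize (H ltac:(intros E'; apply E; rewrite <- E'; ring)).
  assert (Hgf' : locally (T := C_UniformSpace) b (fun w => w <> b -> g w = f_s s w)) by exact Hgf.
  assert (Hne : locally (T := C_UniformSpace) b (fun w => w <> b -> w <> (2 * s)%C)).
  { destruct (excluded_middle_informative (b = (2 * s)%C)) as [E2 | E2].
    - apply filter_forall; intros w Hw; now rewrite <- E2.
    - generalize (locally_neq _ _ E2); apply filter_imp; auto. }
  generalize (filter_and _ _ H (filter_and _ _ Hgf' (filter_and _ _ Hne (locally_strip s b Hb)))).
  intros HL; apply locally_C_disc in HL; destruct HL as [d [Hd HL]].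
  (* At this point other than b, the difference is nonzero by continuity and zero by the
     factorization. *)
  set (w := (b + RtoC (d / 2))%C).
  destruct (HL w) as [A1 [A2 [A3 A4]]].
  { unfold w; replace (b + RtoC (d / 2) - b)%C with (RtoC (d / 2)) by ring.
    rewrite Cmod_R, Rabs_pos_eq; lra. }
  assert (Hwb : w <> b).
  { intros E'; apply (f_equal Re) in E'; unfold w, Re in E'; simpl in E'; lra. }
  apply A1; rewrite (A2 Hwb).
  destruct (f_s_char_fun s w Hs A4 (A3 Hwb)) as [F1 F2]; rewrite F2; field; auto.
Qed.

Lemma char_fun_meromorphic_zero (s : R) (b : C) :
  0 < s < 1 -> strip s (Re b) -> b <> (2 * s)%C -> char_fun s b = 0%C ->
  meromorphic_zero (f_s s) b.
Proof.
  intros Hs Hb Hne E; exists (f_s s); repeat split.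
  - generalize (filter_and _ _ (locally_strip s b Hb) (locally_neq _ _ Hne)).
    intros H; apply (proj1 (locally_C b _)) in H.
    apply locally_locally in H; apply (proj2 (locally_C b _)) in H.
    revert H; apply filter_imp; intros w Hw; apply cdiff_ex_derive.
    apply (proj2 (locally_C w _)) in Hw.
    destruct (locally_singleton _ _ Hw) as [W1 W2].
    apply cdiff_ext_loc with (fun w => char_fun s w / cofactor s w)%C.
    + revert Hw; apply filter_imp; intros v [V1 V2].
      symmetry; now apply f_s_char_fun.
    + apply cdiff_div; [now apply cdiff_char_fun | now apply cdiff_cofactor |].
      now apply f_s_char_fun.
  - apply (filter_forall (F := locally' (T := C_UniformSpace) b)); auto.
  - destruct (f_s_char_fun s b Hs Hb Hne) as [F1 F2]; rewrite F2, E; field; auto.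
Qed.

(** * Zero-free region *)

(** [logmod] and [phase] are the logarithm of the modulus and the argument of the Gamma term at x +
    i y. Since 2 s + 1 - b has imaginary part - y, its [lam] enters [phase] with a minus sign. *)
Definition logmod (s x y : R) : R :=
  ln (sin (PI * s)) - rho (2 * s) 0 + rho (2 * s + 1 - x) y + rho (x + 1) y.
Definition phase (s x y : R) : R := lam (x + 1) y - lam (2 * s + 1 - x) y.
Definition sin_re (s x y : R) : R := sin (PI * (x - s)) * cosh (PI * y).
Definition sin_im (s x y : R) : R := cos (PI * (x - s)) * sinh (PI * y).

Lemma char_fun_zero (s x y : R) : 0 < s < 1 -> strip s x ->
  char_fun s (x, y) = 0%C <->
  sin_re s x y * (x - 2 * s) - sin_im s x y * y = exp (logmod s x y) * cos (phase s x y) /\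
  sin_re s x y * y + sin_im s x y * (x - 2 * s) = exp (logmod s x y) * sin (phase s x y).
Proof.
  intros Hs [Hx1 Hx2].
  assert (Hsin := sin_PI_pos s Hs).
  assert (E1 : Csin (PI * ((x, y) - s)) = (sin_re s x y, sin_im s x y)).
  { unfold sin_re, sin_im; rewrite <- Csin_parts; f_equal; apply C_eq_parts; simpl; ring. }
  assert (E2 : Csin (PI * s) = RtoC (sin (PI * s))).
  { replace (PI * s)%C with ((PI * s, 0) : C) by (apply C_eq_parts; simpl; ring).
    rewrite Csin_parts, cosh_0, sinh_0; apply C_eq_parts; simpl; ring. }
  assert (E3 : CGamma (2 * s) = RtoC (exp (rho (2 * s) 0))).
  { replace (2 * s)%C with ((2 * s, 0) : C) by (apply C_eq_parts; simpl; ring).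
    rewrite CGamma_lgam by (simpl; lra); unfold lgam, Cexp; simpl.
    rewrite lam_0, cos_0, sin_0 by lra; apply C_eq_parts; simpl; ring. }
  assert (E4 : (CGamma (2 * s + 1 - (x, y)) * CGamma ((x, y) + 1))%C
    = Cexp (rho (2 * s + 1 - x) y + rho (x + 1) y, phase s x y)).
  { replace (2 * s + 1 - (x, y))%C with ((2 * s + 1 - x, - y) : C)
      by (apply C_eq_parts; simpl; ring).
    replace ((x, y) + 1)%C with ((x + 1, y) : C) by (apply C_eq_parts; simpl; ring).
    rewrite !CGamma_lgam, <- Cexp_add by (simpl; lra); f_equal.
    unfold lgam, phase; simpl; rewrite rho_opp, lam_opp by lra.
    apply C_eq_parts; simpl; ring. }
  assert (E5 : char_fun s (x, y) =
    (sin_re s x y * (x - 2 * s) - sin_im s x y * y - exp (logmod s x y) * cos (phase s x y),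
     sin_re s x y * y + sin_im s x y * (x - 2 * s) - exp (logmod s x y) * sin (phase s x y))).
  { unfold char_fun; rewrite E1, E2, E3, E4.
    assert (E6 : exp (logmod s x y) = sin (PI * s) * / exp (rho (2 * s) 0)
      * exp (rho (2 * s + 1 - x) y + rho (x + 1) y)).
    { rewrite <- exp_Ropp; rewrite <- (exp_ln (sin (PI * s))) at 1 by easy.
      rewrite <- !exp_plus; f_equal; unfold logmod; ring. }
    rewrite E6; unfold Cdiv; rewrite <- RtoC_inv by apply Rgt_not_eq, exp_pos.
    unfold Cexp; apply C_eq_parts; simpl; ring. }
  rewrite E5; split.
  - intros E; injection E as A B; split; lra.
  - intros [A B]; apply C_eq_parts; simpl; lra.
Qed.

Lemma char_fun_zero_conj (s x y : R) : 0 < s < 1 -> strip s x ->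
  char_fun s (x, y) = 0%C -> char_fun s (x, - y) = 0%C.
Proof.
  intros Hs Hx; rewrite !char_fun_zero by easy.
  destruct Hx as [Hx1 Hx2].
  assert (E1 : sin_re s x (- y) = sin_re s x y).
  { unfold sin_re; rewrite <- (cosh_opp (PI * y)); do 2 f_equal; ring. }
  assert (E2 : sin_im s x (- y) = - sin_im s x y).
  { unfold sin_im; replace (PI * - y) with (- (PI * y)) by ring; rewrite sinh_opp; ring. }
  assert (E3 : logmod s x (- y) = logmod s x y) by (unfold logmod; now rewrite !rho_opp).
  assert (E4 : phase s x (- y) = - phase s x y)
    by (unfold phase; rewrite !lam_opp by lra; ring).
  rewrite E1, E2, E3, E4, cos_neg, sin_neg; intros [A B]; split; lra.
Qed.

(** The sum is ln (n + 1)!, so the sequence is ln n - ln (n + 1). *)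
Lemma rho_1 : rho 1 0 = 0.
Proof.
  apply (is_lim_seq_unique_R (rho_seq 1 0)); [apply rho_lim; lra |].
  apply is_lim_seq_Rabs_le with 1; intros n Hn.
  assert (Hn' : 1 <= INR n) by now apply (le_INR 1).
  assert (E : forall k, sum_f_R0 (fun k => ln ((1 + INR k) ^ 2 + 0 ^ 2) / 2) k
    = ln (INR (fact (S k)))).
  { induction k as [| k IH].
    - cbv [sum_f_R0]; rewrite ln_sqr_half by (simpl; lra); simpl; now rewrite Rplus_0_r.
    - rewrite tech5, IH, ln_sqr_half, (fact_succ_ln (S k)) by (assert (H := pos_INR (S k)); lra).
      rewrite (Rplus_comm 1 (INR (S k))); ring. }
  unfold rho_seq; rewrite E, fact_succ_ln.
  assert (H1 := ln_le_sub ((INR n + 1) / INR n) ltac:(apply Rdiv_lt_0_compat; lra)).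
  rewrite ln_div in H1 by lra.
  replace ((INR n + 1) / INR n - 1) with (1 / INR n) in H1 by (field; lra).
  assert (ln (INR n) < ln (INR n + 1)) by (apply ln_increasing; lra).
  apply Rabs_le; lra.
Qed.

Lemma phase_0 (s x : R) : 0 < s -> strip s x -> phase s x 0 = 0.
Proof. intros Hs [H1 H2]; unfold phase; rewrite !lam_0 by lra; ring. Qed.

(** The product Gamma(2 s + 1 - b) Gamma(b + 1) is invariant under b -> 2 s - b; on the axis x = s
    the two real parts agree. *)
Lemma phase_pos (s x y : R) : 0 < s -> strip s x -> s < x -> 0 < y -> 0 < phase s x y.
Proof.
  intros Hs [H1 H2] Hx Hy; unfold phase.
  assert (H := lam_incr (x + 1) (2 * s + 1 - x) y ltac:(lra) Hy); lra.
Qed.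

Lemma phase_le_0 (s x y : R) : 0 < s -> strip s x -> x <= s -> 0 < y -> phase s x y <= 0.
Proof.
  intros Hs [H1 H2] [Hx | ->] Hy; unfold phase.
  - assert (H := lam_incr (2 * s + 1 - x) (x + 1) y ltac:(lra) Hy); lra.
  - replace (2 * s + 1 - s) with (s + 1) by ring; lra.
Qed.

(** x <= 2 s gives 2 s + 1 - x >= 1, as [lam_diff_lt] requires, and the two real parts differ by 2
    (x - s). *)
Lemma phase_lt (s x y : R) : 0 < s -> s < x <= 2 * s -> 0 < y -> phase s x y < PI * (x - s).
Proof.
  intros Hs Hx Hy; unfold phase.
  assert (H := lam_diff_lt (x + 1) (2 * s + 1 - x) y ltac:(lra) Hy).
  replace ((x + 1 - (2 * s + 1 - x)) * (PI / 2)) with (PI * (x - s)) in H by field; exact H.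
Qed.

Lemma Rmin_half (s : R) : Rmin s (1 / 2) <= s /\ Rmin s (1 / 2) <= 1 / 2.
Proof. split; [apply Rmin_l | apply Rmin_r]. Qed.

(* Right of the symmetry line [x = s]: the real part of [sin (PI (b - s)) e^(- i phase)] is
   positive, that of [1 / (b - 2 s)] is not. *)
Lemma char_fun_neq_0_right (s x y : R) : 0 < s < 1 -> strip s x ->
  s < x <= s + Rmin s (1 / 2) -> 0 < y -> char_fun s (x, y) <> 0%C.
Proof.
  intros Hs Hx Hm Hy; rewrite char_fun_zero by easy; intros [A B].
  destruct (Rmin_half s) as [M1 M2]; assert (Hpi := PI_RGT_0).
  assert (P1 := phase_pos s x y ltac:(lra) Hx ltac:(lra) Hy).
  assert (P2 := phase_lt s x y ltac:(lra) ltac:(lra) Hy).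
  assert (P3 : phase s x y < PI / 2) by nra.
  assert (C1 := cos_gt_0 (phase s x y) ltac:(lra) P3).
  assert (S1 := sin_gt_0 (phase s x y) P1 ltac:(lra)).
  assert (Hp : 0 < sin_re s x y).
  { apply Rmult_lt_0_compat; [apply sin_PI_pos; lra | apply cosh_pos]. }
  assert (Hq : 0 <= sin_im s x y).
  { apply Rmult_le_pos; [apply cos_ge_0; nra | apply Rlt_le, sinh_pos; nra]. }
  set (p := sin_re s x y) in *; set (q := sin_im s x y) in *.
  set (c := cos (phase s x y)) in *; set (d := sin (phase s x y)) in *.
  assert (HT := exp_pos (logmod s x y)); set (T := exp (logmod s x y)) in *.
  (* Real part of the equation multiplied by the conjugate p - i q, in which i y drops out. *)
  assert (E : T * (p * c + q * d) = (p ^ 2 + q ^ 2) * (x - 2 * s)).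
  { transitivity (p * (T * c) + q * (T * d)); [ring | rewrite <- A, <- B; ring]. }
  assert (0 < p * c + q * d) by nra.
  assert (0 < T * (p * c + q * d)) by now apply Rmult_lt_0_compat.
  assert (0 <= p ^ 2 + q ^ 2) by nra.
  nra.
Qed.

(* Left of the symmetry line, [phase + atan (y / (2 s - x))] is the argument of
   [Gamma (b + 1) Gamma (2 s - b)], which lies in the open first quadrant while
   [- sin (PI (b - s))] lies in the fourth one. *)
Lemma char_fun_neq_0_left (s x y : R) : 0 < s < 1 -> strip s x ->
  x <= s -> 0 < y -> char_fun s (x, y) <> 0%C.
Proof.
  intros Hs Hx Hm Hy; rewrite char_fun_zero by easy; intros [A B].
  assert (Hpi := PI_RGT_0).
  assert (P1 := phase_le_0 s x y ltac:(lra) Hx Hm Hy).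
  destruct Hx as [Hx1 Hx2].
  (* 2 s - x < x + 1 because x exceeds both 0 and 2 s - 1; by [lam_incr] this makes the argument of
     Gamma(b + 1) Gamma(2 s - b) positive. *)
  set (r := 2 * s - x); assert (Hr : 0 < r < x + 1) by (unfold r; lra).
  set (th := atan (y / r)).
  assert (T2 : th < PI / 2) by apply atan_bound.
  assert (P2 : 0 < phase s x y + th).
  { unfold phase, th; replace (2 * s + 1 - x) with (r + 1) by (unfold r; ring).
    rewrite (lam_succ r) by easy.
    assert (H := lam_incr (x + 1) r y Hr Hy); lra. }
  assert (S1 := sin_gt_0 (phase s x y + th) P2 ltac:(lra)).
  destruct (atan_div_polar r y (proj1 Hr)) as [Ec Es]; fold th in Ec, Es.
  assert (Hs2 : 0 < sqrt (r ^ 2 + y ^ 2)) by (apply sqrt_lt_R0; nra).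
  assert (Hq : 0 < sin_im s x y).
  { apply Rmult_lt_0_compat; [apply cos_PI_pos; lra | apply sinh_pos; nra]. }
  rewrite sin_plus, Ec, Es in S1.
  replace (x - 2 * s) with (- r) in * by (unfold r; ring).
  set (p := sin_re s x y) in *; set (q := sin_im s x y) in *.
  set (c := cos (phase s x y)) in *; set (d := sin (phase s x y)) in *.
  assert (HT := exp_pos (logmod s x y)); set (T := exp (logmod s x y)) in *.
  set (h := sqrt (r ^ 2 + y ^ 2)) in *.
  replace (d * (r / h) + c * (y / h)) with ((d * r + c * y) / h) in S1 by (field; lra).
  assert (S2 : 0 < d * r + c * y).
  { apply Rmult_lt_reg_r with (/ h); [now apply Rinv_0_lt_compat |].
    rewrite Rmult_0_l; exact S1. }
  (* Imaginary part of the equation multiplied by the conjugate of b - 2 s = - r + i y; the two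
     sides have opposite signs. *)
  assert (E : T * (d * r + c * y) = - q * (r ^ 2 + y ^ 2)).
  { transitivity ((T * d) * r + (T * c) * y); [ring | rewrite <- A, <- B; ring]. }
  assert (0 < T * (d * r + c * y)) by now apply Rmult_lt_0_compat.
  nra.
Qed.

(** For x >= s the sine term is at most 0 and the Gamma term positive. For x < s both are positive,
    and convexity gives Gamma(2 s - x) Gamma(1 + x) >= Gamma(2 s) Gamma(1), so that the Gamma term
    is at least sin(pi s) (2 s - x), more than sin(pi (s - x)) (2 s - x). *)
Lemma char_fun_neq_0_real (s x : R) : 0 < s < 1 -> strip s x ->
  x <= s + Rmin s (1 / 2) -> char_fun s (x, 0) <> 0%C.
Proof.
  intros Hs Hx Hm; rewrite char_fun_zero by easy; intros [A _]; revert A.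
  rewrite phase_0, cos_0 by (auto; lra).
  unfold sin_re, sin_im; rewrite Rmult_0_r, cosh_0, sinh_0.
  assert (HT := exp_pos (logmod s x 0)); intros A.
  destruct (Rmin_half s) as [M1 M2]; assert (Hpi := PI_RGT_0); destruct Hx as [Hx1 Hx2].
  destruct (Rle_lt_dec s x) as [H | H].
  { assert (0 <= sin (PI * (x - s))) by (apply sin_ge_0; nra); nra. }
  (* Both pairs have sum 2 s + 1, and the products differ by x (2 s - 1 - x) < 0. *)
  assert (Hc := rho_convex (2 * s - x) (1 + x) (2 * s) 1 ltac:(lra) ltac:(lra) ltac:(lra)
    ltac:(lra) ltac:(ring) ltac:(nra)).
  rewrite rho_1, Rmult_1_r in Hc.
  assert (Hl : ln ((2 * s - x) * (1 + x)) <= ln (2 * s)) by (apply ln_le; nra).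
  assert (Hr : rho (2 * s + 1 - x) 0 = rho (2 * s - x) 0 + ln (2 * s - x)).
  { replace (2 * s + 1 - x) with (2 * s - x + 1) by ring.
    rewrite rho_succ, ln_sqr_half by lra; reflexivity. }
  assert (HL : ln (sin (PI * s)) + ln (2 * s - x) <= logmod s x 0).
  { unfold logmod; rewrite Hr, (Rplus_comm x 1); lra. }
  assert (HE : sin (PI * s) * (2 * s - x) <= exp (logmod s x 0)).
  { rewrite <- (exp_ln (sin (PI * s))), <- (exp_ln (2 * s - x)), <- exp_plus
      by (try apply sin_PI_pos; lra).
    destruct HL as [HL | ->]; [left; now apply exp_increasing | lra]. }
  (* For s > 1/2 the right side is reflected to sin(pi (1 - s)); s - x < 1 - s is the bound 2 s - 1
     < x. *)
  assert (HS : sin (PI * (s - x)) < sin (PI * s)).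
  { destruct (Rle_lt_dec s (1 / 2)).
    - apply sin_increasing_1; nra.
    - rewrite <- (sin_PI_x (PI * s)); apply sin_increasing_1; nra. }
  replace (PI * (x - s)) with (- (PI * (s - x))) in A by ring; rewrite sin_neg in A.
  nra.
Qed.

Lemma char_fun_neq_0 (s : R) (b : C) : 0 < s < 1 -> strip s (Re b) ->
  Re b <= s + Rmin s (1 / 2) -> char_fun s b <> 0%C.
Proof.
  destruct b as [x y]; simpl; intros Hs Hx Hm.
  assert (Hpos : forall y, 0 < y -> char_fun s (x, y) <> 0%C).
  { intros t Ht; destruct (Rle_lt_dec x s).
    - now apply char_fun_neq_0_left.
    - now apply char_fun_neq_0_right. }
  destruct (Rtotal_order y 0) as [H | [-> | H]].
  - intros E; apply char_fun_zero_conj in E; auto; revert E; apply Hpos; lra.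
  - now apply char_fun_neq_0_real.
  - now apply Hpos.
Qed.

(** * Comparison of moduli *)

(** Difference of the squared moduli, with |sin(pi (u + i y))|^2 written as sin(pi u)^2 + sinh(pi
    y)^2 to show its growth in y. *)
Definition mod_gap (s x y : R) : R :=
  (sin (PI * (x - s)) ^ 2 + sinh (PI * y) ^ 2) * ((x - 2 * s) ^ 2 + y ^ 2)
  - exp (logmod s x y) ^ 2.

Lemma sin_re_im_sqr (s x y : R) :
  sin_re s x y ^ 2 + sin_im s x y ^ 2 = sin (PI * (x - s)) ^ 2 + sinh (PI * y) ^ 2.
Proof.
  unfold sin_re, sin_im; rewrite !Rpow_mult_distr, cosh_sqr.
  assert (H := sin2_cos2 (PI * (x - s))); unfold Rsqr in H.
  replace (cos (PI * (x - s)) ^ 2) with (1 - sin (PI * (x - s)) ^ 2) by (rewrite <- H; ring).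
  ring.
Qed.

Lemma mod_gap_zero (s x y : R) : 0 < s < 1 -> strip s x ->
  char_fun s (x, y) = 0%C -> mod_gap s x y = 0.
Proof.
  intros Hs Hx E; apply char_fun_zero in E; auto; destruct E as [A B].
  unfold mod_gap; rewrite <- sin_re_im_sqr.
  assert (H := sin2_cos2 (phase s x y)); unfold Rsqr in H.
  set (p := sin_re s x y) in *; set (q := sin_im s x y) in *; set (T := exp (logmod s x y)) in *.
  transitivity ((p * (x - 2 * s) - q * y) ^ 2 + (p * y + q * (x - 2 * s)) ^ 2 - T ^ 2); [ring |].
  rewrite A, B.
  transitivity (T ^ 2 * (sin (phase s x y) * sin (phase s x y)
    + cos (phase s x y) * cos (phase s x y)) - T ^ 2); [ring | rewrite H; ring].
Qed.

Lemma logmod_decr (s x y y' : R) : strip s x -> 0 <= y <= y' -> logmod s x y' <= logmod s x y.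
Proof.
  intros [H1 H2] Hy; unfold logmod.
  assert (A := rho_decr (2 * s + 1 - x) y y' ltac:(lra) Hy).
  assert (B := rho_decr (x + 1) y y' ltac:(lra) Hy); lra.
Qed.

Lemma exp_le (a b : R) : a <= b -> exp a <= exp b.
Proof. intros [H | ->]; [left; now apply exp_increasing | lra]. Qed.

Lemma mod_gap_incr (s x y y' : R) : strip s x -> 0 <= y < y' -> mod_gap s x y < mod_gap s x y'.
Proof.
  intros Hx Hy; unfold mod_gap; assert (Hpi := PI_RGT_0).
  assert (L := exp_le _ _ (logmod_decr s x y y' Hx ltac:(lra))).
  assert (L0 := exp_pos (logmod s x y')).
  assert (S0 : 0 <= sinh (PI * y)).
  { destruct (proj1 Hy) as [H | <-]; [apply Rlt_le, sinh_pos; nra |].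
    rewrite Rmult_0_r, sinh_0; lra. }
  assert (S1 : sinh (PI * y) < sinh (PI * y')) by (apply sinh_incr; nra).
  set (c := sin (PI * (x - s))); set (u := x - 2 * s).
  assert (0 <= c ^ 2) by apply pow2_ge_0; assert (0 <= u ^ 2) by apply pow2_ge_0.
  assert (A : (c ^ 2 + sinh (PI * y) ^ 2) * (u ^ 2 + y ^ 2)
    < (c ^ 2 + sinh (PI * y') ^ 2) * (u ^ 2 + y' ^ 2)).
  { apply Rmult_le_0_lt_compat; nra. }
  nra.
Qed.

Lemma PI_gt_1 : 1 < PI.
Proof. assert (H := PI2_1); lra. Qed.

(** As sinh(pi y) >= y, the first modulus is at least y^2 >= y; the second is at most its value at
    height 0, hence below y. *)
Lemma mod_gap_large (s x y : R) : strip s x -> 1 + exp (logmod s x 0) <= y -> 0 < mod_gap s x y.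
Proof.
  intros Hx Hy; unfold mod_gap; assert (Hpi := PI_gt_1).
  assert (L0 := exp_pos (logmod s x 0)); assert (L1 := exp_pos (logmod s x y)).
  assert (L := exp_le _ _ (logmod_decr s x 0 y Hx ltac:(lra))).
  assert (S := sinh_ge_id (PI * y) ltac:(nra)).
  set (c := sin (PI * (x - s))); set (u := x - 2 * s).
  assert (0 <= c ^ 2) by apply pow2_ge_0; assert (0 <= u ^ 2) by apply pow2_ge_0.
  assert (y <= sinh (PI * y)) by nra.
  assert (A : y ^ 2 * y ^ 2 <= (c ^ 2 + sinh (PI * y) ^ 2) * (u ^ 2 + y ^ 2)).
  { apply Rmult_le_compat; nra. }
  assert (exp (logmod s x y) ^ 2 < y ^ 2) by nra.
  assert (1 <= y ^ 2) by nra.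
  nra.
Qed.

Lemma strip_mid (s x : R) : 0 < s < 1 ->
  s + Rmin s (1 / 2) <= x <= s + Rmin s (1 / 2) + 1 / 2 -> strip s x.
Proof.
  intros Hs Hx; destruct (Rmin_half s) as [M1 M2].
  assert (0 < Rmin s (1 / 2)) by (apply Rmin_pos; lra).
  unfold strip; lra.
Qed.

(** The height in [mod_gap_large] depends on x; with this monotonicity the value at the right end
    serves for all x, so the zeros lie in a compact set. *)
Lemma logmod_incr (s x x' : R) : 0 < s < 1 -> strip s x -> strip s x' -> s <= x <= x' ->
  logmod s x 0 <= logmod s x' 0.
Proof.
  intros Hs [H1 H2] [H1' H2'] Hx; unfold logmod.
  assert (A := rho_convex (2 * s + 1 - x') (x' + 1) (2 * s + 1 - x) (x + 1)
    ltac:(lra) ltac:(lra) ltac:(lra) ltac:(lra) ltac:(ring) ltac:(nra)).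
  assert (ln ((2 * s + 1 - x') * (x' + 1)) <= ln ((2 * s + 1 - x) * (x + 1)))
    by (apply ln_le; nra).
  lra.
Qed.

Lemma zero_height (s x y : R) : 0 < s < 1 ->
  s + Rmin s (1 / 2) <= x <= s + Rmin s (1 / 2) + 1 / 2 -> char_fun s (x, y) = 0%C ->
  Rabs y <= 1 + exp (logmod s (s + Rmin s (1 / 2) + 1 / 2) 0).
Proof.
  intros Hs Hx E; set (x1 := s + Rmin s (1 / 2) + 1 / 2) in *.
  assert (0 < Rmin s (1 / 2)) by (apply Rmin_pos; lra).
  assert (Hst := strip_mid s x Hs Hx).
  assert (Hst1 := strip_mid s x1 Hs ltac:(unfold x1; lra)).
  assert (L := exp_le _ _ (logmod_incr s x x1 Hs Hst Hst1 ltac:(lra))).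
  assert (E' : char_fun s (x, Rabs y) = 0%C).
  { unfold Rabs; destruct Rcase_abs; auto; now apply char_fun_zero_conj. }
  apply mod_gap_zero in E'; auto.
  destruct (Rle_lt_dec (Rabs y) (1 + exp (logmod s x1 0))) as [H' | H']; auto; exfalso.
  assert (G := mod_gap_large s x (Rabs y) Hst ltac:(lra)); lra.
Qed.

Lemma zero_free_margin (s : R) : 0 < s < 1 ->
  exists alpha, 0 < alpha <= 1 / 2 /\
    forall b, s + Rmin s (1 / 2) < Re b < s + Rmin s (1 / 2) + alpha -> char_fun s b <> 0%C.
Proof.
  intros Hs; set (x0 := s + Rmin s (1 / 2)).
  assert (Hst := strip_mid s x0 Hs ltac:(unfold x0; lra)).
  set (Y := 1 + exp (logmod s (x0 + 1 / 2) 0)).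
  (* The radius is 2 d because the real and imaginary displacements will each be bounded by d. *)
  assert (Hd : forall y, exists d : posreal, forall w, Cmod (w - (x0, y)) < 2 * d -> char_fun s w <> 0%C).
  { intros y.
    assert (Hc := cdiff_continuous _ _ (cdiff_char_fun s (x0, y) Hs Hst)).
    assert (Hn := continuous_C_neq_0 _ _ Hc
      (char_fun_neq_0 s (x0, y) Hs Hst ltac:(simpl; unfold x0; lra))).
    apply locally_C_disc in Hn; destruct Hn as [d [Hd Hn]].
    exists (mkposreal (d / 2) ltac:(lra)); simpl; intros w Hw; apply Hn; lra. }
  set (delta := fun y => proj1_sig (constructive_indefinite_description _ (Hd y))).
  assert (Hdelta : forall y w, Cmod (w - (x0, y)) < 2 * delta y -> char_fun s w <> 0%C).
  { intros y; unfold delta; now destruct constructive_indefinite_description. }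
  destruct (compactness_value_1d (- Y) Y delta) as [d Hcomp].
  (* Every y in [-Y, Y] is within [delta t] of some t with d <= [delta t]; 1/2 keeps b where
     [zero_height] applies. *)
  exists (Rmin d (1 / 2)); split.
  { split; [apply Rmin_pos; [apply cond_pos | lra] | apply Rmin_r]. }
  intros [x y] Hx E; simpl in Hx.
  assert (D1 := Rmin_l d (1 / 2)); assert (D2 := Rmin_r d (1 / 2)).
  assert (Hy := zero_height s x y Hs ltac:(fold x0; lra) E); fold x0 Y in Hy.
  apply Rabs_le_between in Hy.
  apply (Hcomp y Hy); intros [t [Ht1 [Ht2 Ht3]]].
  apply (Hdelta t (x, y)); auto.
  eapply Rle_lt_trans; [apply Cmod_le_parts |]; simpl.
  rewrite (Rabs_pos_eq (x + - x0)) by lra; unfold Rminus in Ht2; lra.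
Qed.

(** Joint continuity of [rho] and [lam] in both variables is read off from the differentiability of
    [lgam]. *)
Lemma continuous_lgam_comp {U : UniformSpace} (f g : U -> R) (t : U) :
  continuous f t -> continuous g t -> 0 < f t ->
  continuous (U := C_UniformSpace) (fun u => lgam (f u, g u)) t.
Proof.
  intros Hf Hg H.
  apply (continuous_comp (V := C_UniformSpace) (W := C_UniformSpace) (fun u => (f u, g u)) lgam).
  - now apply continuous_C_pair.
  - now apply cdiff_continuous, cdiff_lgam.
Qed.

Lemma continuous_rho {U : UniformSpace} (f g : U -> R) (t : U) :
  continuous f t -> continuous g t -> 0 < f t -> continuous (fun u => rho (f u) (g u)) t.
Proof. intros Hf Hg H; exact (continuous_Re _ _ (continuous_lgam_comp f g t Hf Hg H)). Qed.

Lemma continuous_lam {U : UniformSpace} (f g : U -> R) (t : U) :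
  continuous f t -> continuous g t -> 0 < f t -> continuous (fun u => lam (f u) (g u)) t.
Proof. intros Hf Hg H; exact (continuous_Im _ _ (continuous_lgam_comp f g t Hf Hg H)). Qed.

Lemma continuous_Rplus {U : UniformSpace} (f g : U -> R) (t : U) :
  continuous f t -> continuous g t -> continuous (fun u => f u + g u) t.
Proof. exact (continuous_plus (V := R_NormedModule) f g t). Qed.

Lemma continuous_Rminus {U : UniformSpace} (f g : U -> R) (t : U) :
  continuous f t -> continuous g t -> continuous (fun u => f u - g u) t.
Proof. exact (continuous_minus (V := R_NormedModule) f g t). Qed.

Lemma continuous_Rmult {U : UniformSpace} (f g : U -> R) (t : U) :
  continuous f t -> continuous g t -> continuous (fun u => f u * g u) t.
Proof. exact (continuous_mult (K := R_AbsRing) f g t). Qed.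

Lemma continuous_continuity {U : UniformSpace} (h : R -> R) (f : U -> R) (t : U) :
  continuity h -> continuous f t -> continuous (fun u => h (f u)) t.
Proof.
  intros Hh Hf; apply (continuous_comp f h); auto.
  apply continuity_pt_filterlim, Hh.
Qed.

Ltac continuous_tac :=
  repeat match goal with
  | |- continuous (fun _ => ?a) _ => apply continuous_const
  | |- continuous (fun u => u) _ => apply continuous_id
  | |- continuous (fun u => exp _) _ =>
      apply (continuous_continuity exp); [apply derivable_continuous, derivable_exp |]
  | |- continuous (fun u => sin _) _ => apply (continuous_continuity sin); [apply continuity_sin |]
  | |- continuous (fun u => cos _) _ => apply (continuous_continuity cos); [apply continuity_cos |]
  | |- continuous (fun u => sinh _) _ =>
      apply (continuous_continuity sinh); [apply derivable_continuous, derivable_sinh |]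
  | |- continuous (fun u => cosh _) _ =>
      apply (continuous_continuity cosh); [apply derivable_continuous, derivable_cosh |]
  | |- continuous (fun u => pow _ ?n) _ =>
      apply (continuous_continuity (fun v => v ^ n));
        [apply derivable_continuous, derivable_pow |]
  | |- continuous (fun u => rho _ _) _ => apply continuous_rho
  | |- continuous (fun u => lam _ _) _ => apply continuous_lam
  | |- continuous (fun u => Rplus _ _) _ => apply continuous_Rplus
  | |- continuous (fun u => Rminus _ _) _ => apply continuous_Rminus
  | |- continuous (fun u => Rmult _ _) _ => apply continuous_Rmult
  end; auto; try lra.

Lemma continuous_logmod {U : UniformSpace} (s : R) (f g : U -> R) (t : U) :
  strip s (f t) -> continuous f t -> continuous g t -> continuous (fun u => logmod s (f u) (g u)) t.
Proof. intros [H1 H2] Hf Hg; unfold logmod; continuous_tac. Qed.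

Lemma continuous_phase {U : UniformSpace} (s : R) (f g : U -> R) (t : U) :
  strip s (f t) -> continuous f t -> continuous g t -> continuous (fun u => phase s (f u) (g u)) t.
Proof. intros [H1 H2] Hf Hg; unfold phase; continuous_tac. Qed.

Lemma continuous_mod_gap {U : UniformSpace} (s : R) (f g : U -> R) (t : U) :
  strip s (f t) -> continuous f t -> continuous g t -> continuous (fun u => mod_gap s (f u) (g u)) t.
Proof.
  intros H Hf Hg; unfold mod_gap; continuous_tac; now apply continuous_logmod.
Qed.

Lemma IVT_open (f : R -> R) (a b : R) : a < b -> (forall t, a <= t <= b -> continuous f t) ->
  f a < 0 < f b -> exists t, a < t < b /\ f t = 0.
Proof.
  intros Hab Hc [Ha Hb].
  destruct (Ranalysis5.IVT_interv f a b) as [t [Ht E]]; auto.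
  { intros t Ht; now apply continuity_pt_filterlim, Hc. }
  exists t; split; auto.
  destruct (Req_dec t a) as [-> |]; [lra |]; destruct (Req_dec t b) as [-> |]; lra.
Qed.

(** * Existence of a zero *)

(** The negative of [char_fun] on the real part of the strip. *)
Definition real_gap (s x : R) : R := exp (logmod s x 0) - sin (PI * (x - s)) * (x - 2 * s).

Lemma continuous_real_gap (s x : R) : strip s x -> continuous (real_gap s) x.
Proof.
  intros Hx; unfold real_gap; continuous_tac.
  apply (continuous_logmod s (fun u => u) (fun _ => 0)); auto;
    [apply continuous_id | apply continuous_const].
Qed.

Lemma real_gap_zero (s x : R) : 0 < s < 1 -> strip s x -> real_gap s x = 0 ->
  char_fun s (x, 0) = 0%C.
Proof.
  unfold real_gap; intros Hs Hx E; apply char_fun_zero; auto.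
  unfold sin_re, sin_im; rewrite phase_0, cos_0, sin_0, Rmult_0_r, cosh_0, sinh_0 by (auto; lra).
  lra.
Qed.

Lemma real_gap_left (s : R) : 0 < s < 1 -> 0 < real_gap s (s + Rmin s (1 / 2)).
Proof.
  intros Hs; unfold real_gap; destruct (Rmin_half s) as [M1 M2].
  assert (0 < Rmin s (1 / 2)) by (apply Rmin_pos; lra).
  replace (s + Rmin s (1 / 2) - s) with (Rmin s (1 / 2)) by ring.
  assert (H1 := sin_PI_pos (Rmin s (1 / 2)) ltac:(lra)).
  assert (H2 := exp_pos (logmod s (s + Rmin s (1 / 2)) 0)); nra.
Qed.

(* Moving to the left by [e = s / 20] costs the factor [1 - 4 e^2] in
   [(1 / 2 - e) (1 / 2 + e)], but [rho_convex] at [3 / 2] and [2 s + 3 / 2] wins the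
   larger factor [1 + e (2 s - e) / (3 / 2 (2 s + 3 / 2))]. *)
Lemma real_gap_perturb (s : R) : 0 < s <= 1 / 2 -> real_gap s (2 * s + 1 / 2) <= 0 ->
  real_gap s (2 * s + 1 / 2 - s / 20) < 0.
Proof.
  unfold real_gap; intros Hs; set (e := s / 20); assert (He : s = 20 * e) by (unfold e; field).
  assert (Hpi := PI_RGT_0).
  replace (2 * s + 1 / 2 - s) with (s + 1 / 2) by ring.
  replace (2 * s + 1 / 2 - 2 * s) with (1 / 2) by ring.
  replace (2 * s + 1 / 2 - e - s) with (s - e + 1 / 2) by ring.
  replace (2 * s + 1 / 2 - e - 2 * s) with (1 / 2 - e) by ring.
  assert (Hsc : forall t, sin (PI * (t + 1 / 2)) = cos (PI * t)).
  { intros t; rewrite cos_sin; f_equal; field. }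
  rewrite !Hsc; intros H.
  assert (Hc : cos (PI * s) <= cos (PI * (s - e))) by (apply cos_decr_1; nra).
  set (L1 := logmod s (2 * s + 1 / 2) 0) in *; set (L := logmod s (2 * s + 1 / 2 - e) 0).
  set (a := 3 / 2); set (b := 2 * s + 3 / 2); set (a' := 3 / 2 + e); set (b' := 2 * s + 3 / 2 - e).
  assert (Ha : 0 < a) by (unfold a; lra); assert (Hb : 0 < b) by (unfold b; lra).
  assert (Ha' : 0 < a') by (unfold a'; lra); assert (Hb' : 0 < b') by (unfold b'; lra).
  assert (Hab : a' * b' = a * b + 39 * e ^ 2)
    by (unfold a, b, a', b'; rewrite He; field).
  assert (Hcv := rho_convex a b a' b' Ha Hb Ha' Hb' ltac:(unfold a, b, a', b'; ring)
    ltac:(rewrite Hab; nra)).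
  assert (E1 : rho (2 * s + 1 - (2 * s + 1 / 2)) 0 = rho a 0 - ln (1 / 2)).
  { replace (2 * s + 1 - (2 * s + 1 / 2)) with (1 / 2) by field.
    replace a with (1 / 2 + 1) by (unfold a; field); rewrite rho_succ, ln_sqr_half by lra; ring. }
  assert (E2 : rho (2 * s + 1 - (2 * s + 1 / 2 - e)) 0 = rho a' 0 - ln (1 / 2 + e)).
  { replace (2 * s + 1 - (2 * s + 1 / 2 - e)) with (1 / 2 + e) by field.
    replace a' with (1 / 2 + e + 1) by (unfold a'; field);
      rewrite rho_succ, ln_sqr_half by lra; ring. }
  assert (E3 : 2 * s + 1 / 2 + 1 = b) by (unfold b; field).
  assert (E4 : 2 * s + 1 / 2 - e + 1 = b') by (unfold b'; field).
  assert (HL : L + ln (1 / 2 + e) + ln (a' * b') <= L1 + ln (1 / 2) + ln (a * b)).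
  { unfold L, L1, logmod; rewrite E1, E2, E3, E4; lra. }
  apply exp_le in HL; rewrite !exp_plus, !exp_ln in HL by nra.
  assert (P1 := exp_pos L1); assert (P := exp_pos L).
  set (T1 := exp L1) in *; set (T := exp L) in *.
  assert (He0 : 0 < e <= 1 / 40) by lra.
  assert (Hc0 : 2 * T1 <= cos (PI * s)) by lra.
  (* Equivalent to a b < (1 - 4 e^2) (a b + 39 e^2), that is, 0 < 39 - 4 a b - 156 e^2; here 4 a b
     <= 15. *)
  assert (Hk : (1 / 2) * (a * b) < (1 - 2 * e) * (1 / 2 + e) * (a' * b')).
  { rewrite Hab; replace ((1 - 2 * e) * (1 / 2 + e)) with (1 / 2 * (1 - 4 * e ^ 2)) by field.
    assert (a * b <= 15 / 4) by (unfold a, b; nra).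
    assert (e ^ 2 <= 1 / 1600) by nra; assert (0 < e ^ 2) by nra.
    assert (0 < e ^ 2 * (39 - 4 * (a * b) - 156 * e ^ 2)) by (apply Rmult_lt_0_compat; lra).
    lra. }
  assert (HT : T < T1 * (1 - 2 * e)).
  { assert (0 < (1 / 2 + e) * (a' * b')) by nra.
    apply Rmult_lt_reg_r with ((1 / 2 + e) * (a' * b')); auto; nra. }
  nra.
Qed.

(** The delicate case is a gap vanishing at the right end, which the open strip excludes. For s <=
    1/2 [real_gap_perturb] supplies a negative value further left; for s > 1/2 the sine vanishes at
    that end and the gap is positive. *)
Lemma real_zero (s : R) : 0 < s < 1 ->
  (exists x, s + Rmin s (1 / 2) <= x <= s + Rmin s (1 / 2) + 1 / 2 /\ real_gap s x <= 0) ->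
  exists x, s + Rmin s (1 / 2) < x < s + Rmin s (1 / 2) + 1 / 2 /\ char_fun s (x, 0) = 0%C.
Proof.
  intros Hs [x1 [Hx1 G1]]; set (x0 := s + Rmin s (1 / 2)) in *.
  assert (G0 := real_gap_left s Hs); fold x0 in G0.
  assert (Hneg : forall x, x0 <= x <= x0 + 1 / 2 -> real_gap s x < 0 ->
    exists x, x0 < x < x0 + 1 / 2 /\ char_fun s (x, 0) = 0%C).
  { intros x Hx G.
    assert (x0 < x) by (destruct (Req_dec x x0) as [-> |]; lra).
    destruct (IVT_open (fun t => - real_gap s t) x0 x) as [t [Ht E]]; [lra | | lra |].
    - intros t Ht; apply (continuous_opp (V := R_NormedModule)), continuous_real_gap.
      apply strip_mid; auto; fold x0; lra.
    - exists t; split; [lra |]; apply real_gap_zero; auto; [| lra].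
      apply strip_mid; auto; fold x0; lra. }
  destruct (Req_dec (real_gap s x1) 0) as [E1 | E1]; [| apply (Hneg x1 Hx1); lra].
  destruct (Rlt_le_dec x1 (x0 + 1 / 2)) as [L | L].
  - exists x1; split; [destruct (Req_dec x1 x0) as [-> |]; lra |].
    apply real_gap_zero; auto; apply strip_mid; auto.
  - assert (Ex : x1 = x0 + 1 / 2) by lra.
    destruct (Rle_lt_dec s (1 / 2)) as [Hh | Hh].
    + assert (E0 : x0 = 2 * s) by (unfold x0; rewrite Rmin_left by lra; ring).
      apply (Hneg (2 * s + 1 / 2 - s / 20)); [rewrite E0; lra |].
      apply real_gap_perturb; [lra | rewrite <- E0, <- Ex; lra].
    + exfalso; revert E1; rewrite Ex; unfold x0; rewrite Rmin_right by lra.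
      unfold real_gap; replace (s + 1 / 2 + 1 / 2 - s) with 1 by field.
      rewrite Rmult_1_r, sin_PI.
      assert (H := exp_pos (logmod s (s + 1 / 2 + 1 / 2) 0)); lra.
Qed.

(* The argument of [(X, Y)], off the closed negative real half-line. *)
Definition carg (X Y : R) : R := 2 * atan (Y / (sqrt (X ^ 2 + Y ^ 2) + X)).

(** Half-angle formula: with r the modulus, Y / (r + X) is the tangent of half the argument and,
    unlike Y / X, is finite on the imaginary axis off 0. *)
Lemma carg_polar (X Y : R) : 0 < sqrt (X ^ 2 + Y ^ 2) + X ->
  X = sqrt (X ^ 2 + Y ^ 2) * cos (carg X Y) /\ Y = sqrt (X ^ 2 + Y ^ 2) * sin (carg X Y).
Proof.
  intros H; set (r := sqrt (X ^ 2 + Y ^ 2)) in *.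
  assert (Hr2 : r ^ 2 = X ^ 2 + Y ^ 2).
  { unfold r; rewrite pow2_sqrt; auto.
    assert (H1 := pow2_ge_0 X); assert (H2 := pow2_ge_0 Y); lra. }
  assert (Hr : 0 < r).
  { destruct (sqrt_pos (X ^ 2 + Y ^ 2)) as [Hr | Hr]; auto; fold r in Hr.
    rewrite <- Hr in Hr2; assert (H1 := pow2_ge_0 X); assert (H2 := pow2_ge_0 Y).
    assert (X = 0) by nra; lra. }
  unfold carg; fold r.
  destruct (atan_div_polar (r + X) Y H) as [Ec Es].
  set (h := sqrt ((r + X) ^ 2 + Y ^ 2)) in *.
  assert (Hh2 : h ^ 2 = 2 * r * (r + X)).
  { unfold h; rewrite pow2_sqrt; [lra |].
    assert (H1 := pow2_ge_0 (r + X)); assert (H2 := pow2_ge_0 Y); lra. }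
  assert (Hh : 0 < h).
  { destruct (sqrt_pos ((r + X) ^ 2 + Y ^ 2)) as [Hh | Hh]; auto; fold h in Hh.
    rewrite <- Hh in Hh2; nra. }
  rewrite cos_2a, sin_2a, Ec, Es; split.
  - replace ((r + X) / h * ((r + X) / h) - Y / h * (Y / h))
      with (((r + X) ^ 2 - Y ^ 2) / h ^ 2) by (field; lra).
    rewrite Hh2; replace (Y ^ 2) with (r ^ 2 - X ^ 2) by lra; field; lra.
  - replace (2 * (Y / h) * ((r + X) / h)) with (2 * Y * (r + X) / h ^ 2) by (field; lra).
    rewrite Hh2; field; lra.
Qed.

Lemma carg_sign (X Y : R) : 0 < sqrt (X ^ 2 + Y ^ 2) + X ->
  (0 <= Y -> 0 <= carg X Y) /\ (Y <= 0 -> carg X Y <= 0).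
Proof.
  intros H; unfold carg; set (d := sqrt (X ^ 2 + Y ^ 2) + X) in *.
  assert (Hd := Rinv_0_lt_compat _ H).
  split; intros HY.
  - assert (A : 0 <= Y / d) by (apply Rmult_le_pos; lra).
    apply atan_le in A; rewrite atan_0 in A; lra.
  - assert (A : Y / d <= 0) by (unfold Rdiv; nra).
    apply atan_le in A; rewrite atan_0 in A; lra.
Qed.

Lemma carg_imaginary (Y : R) : (0 < Y -> carg 0 Y = PI / 2) /\ (Y < 0 -> carg 0 Y = - (PI / 2)).
Proof.
  unfold carg; replace (0 ^ 2 + Y ^ 2) with (Rsqr Y) by (unfold Rsqr; ring).
  rewrite sqrt_Rsqr_abs, Rplus_0_r; split; intros H.
  - rewrite Rabs_pos_eq by lra; replace (Y / Y) with 1 by (field; lra).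
    rewrite atan_1; field.
  - rewrite Rabs_left by lra; replace (Y / - Y) with (- (1)) by (field; lra).
    rewrite atan_opp, atan_1; field.
Qed.

Lemma carg_real (X : R) : carg X 0 = 0.
Proof. unfold carg, Rdiv; rewrite Rmult_0_l, atan_0; ring. Qed.

(** |Y / (r + X)| <= 1 puts [carg] between - pi/2 and pi/2, where the sine determines the angle. *)
Lemma carg_atan (X Y : R) : 0 < X -> carg X Y = atan (Y / X).
Proof.
  intros HX; set (r := sqrt (X ^ 2 + Y ^ 2)).
  assert (Hr : 0 < r) by (apply sqrt_lt_R0, sum_sqr_pos; lra).
  destruct (carg_polar X Y ltac:(fold r; lra)) as [_ E]; fold r in E.
  destruct (atan_div_polar X Y HX) as [_ E']; fold r in E'.
  assert (HY : - r <= Y <= r).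
  { unfold r; split; [apply Ropp_le_cancel; rewrite Ropp_involutive |].
    - apply Rle_trans with (sqrt (Rsqr Y)); [rewrite sqrt_Rsqr_abs, <- Rabs_Ropp; apply Rle_abs |].
      apply sqrt_le_1_alt; unfold Rsqr; nra.
    - apply Rle_trans with (sqrt (Rsqr Y)); [rewrite sqrt_Rsqr_abs; apply Rle_abs |].
      apply sqrt_le_1_alt; unfold Rsqr; nra. }
  assert (Hq : -1 <= Y / (r + X) <= 1).
  { split; [apply Rle_div_r | apply Rle_div_l]; lra. }
  assert (B1 := atan_le _ _ (proj1 Hq)); assert (B2 := atan_le _ _ (proj2 Hq)).
  rewrite atan_1 in B2; replace (-1) with (- (1)) in B1 by ring; rewrite atan_opp, atan_1 in B1.
  assert (B := atan_bound (Y / X)).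
  apply sin_inj; unfold carg; fold r; [lra | lra |].
  unfold carg in E; fold r in E; rewrite E'.
  apply Rmult_eq_reg_l with r; [rewrite <- E; field; lra | lra].
Qed.

Lemma continuous_carg {U : UniformSpace} (f g : U -> R) (t : U) :
  continuous f t -> continuous g t -> 0 < sqrt (f t ^ 2 + g t ^ 2) + f t ->
  continuous (fun u => carg (f u) (g u)) t.
Proof.
  intros Hf Hg H; unfold carg; apply continuous_Rmult; [apply continuous_const |].
  apply (continuous_continuity atan); [intros v; apply derivable_continuous_pt, derivable_pt_atan |].
  apply continuous_Rdiv; [exact Hg | | lra].
  apply continuous_Rplus; auto.
  apply (continuous_comp (fun u => f u ^ 2 + g u ^ 2) sqrt); [continuous_tac |].
  apply continuous_sqrt.
Qed.

(* [y] is the height at which [|sin (PI (b - s)) (b - 2 s)|] overtakes the modulus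
   of the Gamma term on the vertical line through [x], or 0 if it is larger on the
   whole half-line. *)
Definition is_crossing (s x y : R) : Prop :=
  0 <= y /\ (forall y', y < y' -> 0 < mod_gap s x y') /\
  (forall y', 0 <= y' < y -> mod_gap s x y' < 0).

Lemma crossing_ex (s x : R) : strip s x -> exists y, is_crossing s x y.
Proof.
  intros Hx.
  destruct (Rle_lt_dec 0 (mod_gap s x 0)) as [H | H].
  - exists 0; repeat split; [lra | | intros; lra].
    intros y' Hy'; assert (H1 := mod_gap_incr s x 0 y' Hx ltac:(lra)); lra.
  - set (B := 1 + exp (logmod s x 0)).
    assert (HB : 0 < B) by (unfold B; assert (H1 := exp_pos (logmod s x 0)); lra).
    assert (HB' := mod_gap_large s x B Hx ltac:(unfold B; lra)).
    destruct (IVT_open (mod_gap s x) 0 B) as [y [Hy E]]; auto.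
    { intros t _; apply (continuous_mod_gap s (fun _ => x) (fun u => u)); auto;
        [apply continuous_const | apply continuous_id]. }
    exists y; repeat split; [lra | |]; intros y' Hy'.
    + assert (H1 := mod_gap_incr s x y y' Hx ltac:(lra)); lra.
    + assert (H1 := mod_gap_incr s x y' y Hx ltac:(lra)); lra.
Qed.

Lemma crossing_zero (s x y : R) : strip s x -> is_crossing s x y -> 0 < y -> mod_gap s x y = 0.
Proof.
  intros Hx [_ [H1 H2]] Hy.
  assert (Hc : continuous (mod_gap s x) y).
  { apply (continuous_mod_gap s (fun _ => x) (fun u => u)); auto;
      [apply continuous_const | apply continuous_id]. }
  destruct (Rtotal_order (mod_gap s x y) 0) as [H | [H | H]]; auto; exfalso.
  - specialize (Hc _ (open_lt 0 _ H)); destruct Hc as [d Hd].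
    assert (Hd0 := cond_pos d).
    specialize (Hd (y + d / 2)); specialize (H1 (y + d / 2) ltac:(lra)).
    assert (mod_gap s x (y + d / 2) < 0); [apply Hd | lra].
    unfold ball; simpl; unfold AbsRing_ball, abs, minus, plus, opp; simpl.
    replace (y + d / 2 + - y) with (d / 2) by ring; rewrite Rabs_pos_eq; lra.
  - specialize (Hc _ (open_gt 0 _ H)); destruct Hc as [d Hd].
    assert (Hd0 := cond_pos d).
    assert (Hm := Rmin_l (d / 2) y); assert (Hm' := Rmin_r (d / 2) y).
    assert (Hm0 : 0 < Rmin (d / 2) y) by (apply Rmin_pos; lra).
    set (e := Rmin (d / 2) y) in *.
    specialize (Hd (y - e)); specialize (H2 (y - e) ltac:(lra)).
    assert (0 < mod_gap s x (y - e)); [apply Hd | lra].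
    unfold ball; simpl; unfold AbsRing_ball, abs, minus, plus, opp; simpl.
    replace (y - e + - y) with (- e) by ring; rewrite Rabs_Ropp, Rabs_pos_eq; lra.
Qed.

(** The sign of [mod_gap] at a fixed height tells on which side of it the crossing lies, and is
    stable under small changes of t. Testing the heights Y t0 + eps/2 and Y t0 - eps/2 replaces an
    implicit function theorem and also covers crossings at height 0. *)
Lemma crossing_continuous (s : R) (X Y : R -> R) (t0 : R) :
  (forall t, strip s (X t)) -> (forall t, is_crossing s (X t) (Y t)) ->
  continuous X t0 -> continuous Y t0.
Proof.
  intros HX HY Hc.
  assert (Hg : forall c, continuous (fun t => mod_gap s (X t) c) t0).
  { intros c; apply (continuous_mod_gap s X (fun _ => c)); auto; apply continuous_const. }
  apply filterlim_locally; intros eps; assert (He := cond_pos eps).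
  assert (U : locally t0 (fun t => Y t <= Y t0 + eps / 2)).
  { destruct (HY t0) as [A [B _]].
    assert (L0 : locally t0 (fun t => 0 < mod_gap s (X t) (Y t0 + eps / 2)))
      by exact (Hg (Y t0 + eps / 2) (fun v => 0 < v)
                  (open_gt 0 _ (B (Y t0 + eps / 2) ltac:(lra)))).
    revert L0; apply filter_imp; intros t Ht.
    destruct (Rle_lt_dec (Y t) (Y t0 + eps / 2)) as [L | L]; auto; exfalso.
    destruct (HY t) as [_ [_ C]]; specialize (C (Y t0 + eps / 2) ltac:(lra)); lra. }
  assert (V : locally t0 (fun t => Y t0 - eps / 2 <= Y t)).
  { destruct (Rle_lt_dec 0 (Y t0 - eps / 2)) as [P | P].
    - destruct (HY t0) as [A [_ B]].
      assert (L0 : locally t0 (fun t => mod_gap s (X t) (Y t0 - eps / 2) < 0))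
        by exact (Hg (Y t0 - eps / 2) (fun v => v < 0)
                    (open_lt 0 _ (B (Y t0 - eps / 2) ltac:(lra)))).
      revert L0; apply filter_imp; intros t Ht.
      destruct (Rle_lt_dec (Y t0 - eps / 2) (Y t)) as [L | L]; auto; exfalso.
      destruct (HY t) as [_ [C _]]; specialize (C (Y t0 - eps / 2) ltac:(lra)); lra.
    - apply filter_forall; intros t; destruct (HY t) as [A _]; lra. }
  generalize (filter_and _ _ U V); apply filter_imp; intros t [H1 H2].
  unfold ball; simpl; unfold AbsRing_ball, abs, minus, plus, opp; simpl.
  apply Rabs_lt_between; lra.
Qed.

(* The argument of [sin (PI (b - s)) (b - 2 s)] minus that of the Gamma term; the
   argument of [u + i y] with [y >= 0] is written [PI / 2 + carg y (- u)] so as to be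
   continuous on both real half-lines. *)
Definition arg_gap (s x y : R) : R :=
  carg (sin_re s x y) (sin_im s x y) + (PI / 2 + carg y (- (x - 2 * s))) - phase s x y.

Lemma sqrt_plus_pos (X Y : R) : 0 <= X -> X <> 0 \/ Y <> 0 -> 0 < sqrt (X ^ 2 + Y ^ 2) + X.
Proof.
  intros HX H; assert (H1 := sqrt_lt_R0 _ (sum_sqr_pos X Y H)); lra.
Qed.

Definition on_curve (s x y : R) : Prop :=
  s + Rmin s (1 / 2) <= x <= s + Rmin s (1 / 2) + 1 / 2 /\ is_crossing s x y.

(** At height 0 the sine term is at least the Gamma term in modulus, so a positive [real_gap] forces
    it to be negative; the sine itself is nonnegative. *)
Lemma curve_bottom (s x : R) : 0 < s < 1 -> on_curve s x 0 -> 0 < real_gap s x ->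
  0 < sin (PI * (x - s)) /\ x < 2 * s.
Proof.
  intros Hs [Hx Hc] G; destruct (Rmin_half s) as [M1 M2]; assert (Hpi := PI_RGT_0).
  assert (0 < Rmin s (1 / 2)) by (apply Rmin_pos; lra).
  assert (Hst := strip_mid s x Hs Hx).
  (* [is_crossing] gives the sign only above height 0; continuity extends it. *)
  assert (HF : 0 <= mod_gap s x 0).
  { destruct (Rle_lt_dec 0 (mod_gap s x 0)) as [L | L]; auto; exfalso.
    assert (Hcont : continuous (mod_gap s x) 0).
    { apply (continuous_mod_gap s (fun _ => x) (fun u => u)); auto;
        [apply continuous_const | apply continuous_id]. }
    destruct (Hcont _ (open_lt 0 _ L)) as [d Hd]; assert (Hd0 := cond_pos d).
    specialize (Hd (d / 2)); destruct Hc as [_ [Hc _]]; specialize (Hc (d / 2) ltac:(lra)).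
    assert (mod_gap s x (d / 2) < 0); [apply Hd | lra].
    unfold ball; simpl; unfold AbsRing_ball, abs, minus, plus, opp; simpl.
    replace (d / 2 + - 0) with (d / 2) by ring; rewrite Rabs_pos_eq; lra. }
  assert (Hsin : 0 <= sin (PI * (x - s))) by (apply sin_ge_0; nra).
  unfold mod_gap in HF; rewrite Rmult_0_r, sinh_0 in HF; unfold real_gap in G.
  assert (P := exp_pos (logmod s x 0)).
  set (p := sin (PI * (x - s))) in *; set (u := x - 2 * s) in *; set (T := exp (logmod s x 0)) in *.
  assert (Hpu : T ^ 2 <= (p * u) ^ 2) by (ring_simplify in HF; ring_simplify; lra).
  assert (p * u < 0) by (destruct (Rlt_le_dec (p * u) 0); auto; nra).
  split; [destruct Hsin as [|E]; auto; rewrite <- E in *; lra |].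
  assert (u < 0) by nra; unfold u in *; lra.
Qed.

Lemma curve_args (s x y : R) : 0 < s < 1 -> on_curve s x y -> 0 < real_gap s x ->
  0 < sqrt (sin_re s x y ^ 2 + sin_im s x y ^ 2) + sin_re s x y /\
  0 < sqrt (y ^ 2 + (- (x - 2 * s)) ^ 2) + y.
Proof.
  intros Hs Hc G; destruct (Rmin_half s) as [M1 M2]; assert (Hpi := PI_RGT_0).
  assert (0 < Rmin s (1 / 2)) by (apply Rmin_pos; lra).
  assert (Hy := proj1 (proj2 Hc)); destruct (proj1 Hc) as [Hx1 Hx2].
  assert (Hsin : 0 <= sin (PI * (x - s))) by (apply sin_ge_0; nra).
  assert (Hch := cosh_pos (PI * y)).
  destruct Hy as [Hy | <-].
  - split; apply sqrt_plus_pos; [apply Rmult_le_pos; lra | | lra | lra].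
    destruct (Rlt_le_dec (x - s) 1) as [L | L].
    + left; apply Rgt_not_eq, Rmult_lt_0_compat; auto; apply sin_PI_pos; lra.
    + right; unfold sin_im; replace (x - s) with 1 by lra; rewrite Rmult_1_r, cos_PI.
      assert (Hsh := sinh_pos (PI * y) ltac:(nra)); lra.
  - destruct (curve_bottom s x Hs Hc G) as [A B].
    split; apply sqrt_plus_pos; try lra.
    + apply Rmult_le_pos; lra.
    + left; apply Rgt_not_eq, Rmult_lt_0_compat; auto.
Qed.

(** The two terms are real with opposite signs. Hence a zero of [arg_gap] on the curve has positive
    height. *)
Lemma arg_gap_bottom (s x : R) : 0 < s < 1 -> on_curve s x 0 -> 0 < real_gap s x ->
  arg_gap s x 0 = PI.
Proof.
  intros Hs Hc G; destruct (curve_bottom s x Hs Hc G) as [A B].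
  unfold arg_gap; rewrite phase_0 by (auto using strip_mid, (proj1 Hc); lra).
  unfold sin_im; rewrite Rmult_0_r, sinh_0, Rmult_0_r, carg_real.
  rewrite (proj1 (carg_imaginary _)) by lra; field.
Qed.

(** Both [carg] terms are nonnegative here, and for y > 0 the phase is below pi min(s, 1/2) <=
    pi/2. *)
Lemma arg_gap_left (s y : R) : 0 < s < 1 -> on_curve s (s + Rmin s (1 / 2)) y ->
  0 < arg_gap s (s + Rmin s (1 / 2)) y.
Proof.
  intros Hs Hc; assert (G := real_gap_left s Hs).
  destruct (Rmin_half s) as [M1 M2]; assert (Hpi := PI_RGT_0).
  assert (Hm : 0 < Rmin s (1 / 2)) by (apply Rmin_pos; lra).
  set (x := s + Rmin s (1 / 2)) in *.
  destruct (curve_args s x y Hs Hc G) as [A1 A2].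
  destruct (proj1 (proj2 Hc)) as [Hy | <-]; [| rewrite arg_gap_bottom by auto; lra].
  assert (P := phase_lt s x y ltac:(lra) ltac:(unfold x; lra) Hy).
  assert (C1 : 0 <= carg (sin_re s x y) (sin_im s x y)).
  { apply carg_sign; auto; apply Rmult_le_pos;
      [apply cos_ge_0; unfold x; nra | apply Rlt_le, sinh_pos; nra]. }
  assert (C2 : 0 <= carg y (- (x - 2 * s))) by (apply carg_sign; auto; unfold x; lra).
  unfold arg_gap; unfold x in P at 2; nra.
Qed.

(** If s <= 1/2, then x = 2 s + 1/2: the sine has argument at most 0, and by the functional equation
    the phase exceeds atan(2 y), the argument of b - 2 s. If s > 1/2, then x = s + 1: the sine is -
    i sinh(pi y), of argument - pi/2, while b - 2 s has argument at most pi/2 and the phase is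
    positive. *)
Lemma arg_gap_right (s y : R) : 0 < s < 1 ->
  let x := s + Rmin s (1 / 2) + 1 / 2 in
  on_curve s x y -> 0 < real_gap s x -> arg_gap s x y < 0.
Proof.
  intros Hs x Hc G; destruct (Rmin_half s) as [M1 M2]; assert (Hpi := PI_RGT_0).
  assert (Hm : 0 < Rmin s (1 / 2)) by (apply Rmin_pos; lra).
  destruct (curve_args s x y Hs Hc G) as [A1 A2].
  assert (Hst := strip_mid s x Hs (proj1 Hc)).
  assert (Hm2 : s < Rmin s (1 / 2) + 1 / 2) by (unfold Rmin; destruct Rle_dec; lra).
  (* Height 0 would force x < 2 s, against [Hm2]. *)
  destruct (proj1 (proj2 Hc)) as [Hy | <-];
    [| destruct (curve_bottom s x Hs Hc G); unfold x in *; lra].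
  assert (Hsh := sinh_pos (PI * y) ltac:(nra)).
  destruct (Rle_lt_dec s (1 / 2)) as [Hh | Hh].
  - assert (E : x = 2 * s + 1 / 2) by (unfold x; rewrite Rmin_left by lra; field).
    assert (C1 : carg (sin_re s x y) (sin_im s x y) <= 0).
    { apply carg_sign; auto; unfold sin_im.
      assert (cos (PI * (x - s)) <= 0) by (rewrite E; apply cos_le_0; nra); nra. }
    unfold arg_gap, phase; rewrite (carg_atan y) by auto.
    replace (- (x - 2 * s) / y) with (- / (y / (1 / 2))) by (rewrite E; field; lra).
    rewrite atan_opp, atan_inv by (apply Rdiv_lt_0_compat; lra).
    replace (2 * s + 1 - x) with (1 / 2) by (rewrite E; field).
    assert (L := lam_succ (1 / 2) y ltac:(lra)).
    assert (L' := lam_incr (x + 1) (1 / 2 + 1) y ltac:(lra) Hy); lra.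
  - assert (E : x = s + 1) by (unfold x; rewrite Rmin_right by lra; field).
    assert (P := phase_pos s x y ltac:(lra) Hst ltac:(lra) Hy).
    assert (C2 : carg y (- (x - 2 * s)) <= 0) by (apply carg_sign; auto; rewrite E; lra).
    assert (C1 : carg (sin_re s x y) (sin_im s x y) = - (PI / 2)).
    { unfold sin_re, sin_im; rewrite E; replace (s + 1 - s) with 1 by ring.
      rewrite Rmult_1_r, sin_PI, cos_PI, Rmult_0_l; apply carg_imaginary; lra. }
    unfold arg_gap; lra.
Qed.

Lemma arg_mod_zero (s x y : R) : 0 < s < 1 -> on_curve s x y -> 0 < real_gap s x ->
  0 < y -> arg_gap s x y = 0 -> char_fun s (x, y) = 0%C.
Proof.
  intros Hs Hc G Hy E.
  assert (Hst := strip_mid s x Hs (proj1 Hc)).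
  assert (F := crossing_zero s x y Hst (proj2 Hc) Hy).
  destruct (curve_args s x y Hs Hc G) as [A1 A2].
  destruct (carg_polar _ _ A1) as [P1 P2]; destruct (carg_polar _ _ A2) as [Q1 Q2].
  unfold mod_gap in F; rewrite <- sin_re_im_sqr in F.
  apply char_fun_zero; auto; unfold arg_gap in E.
  set (p := sin_re s x y) in *; set (q := sin_im s x y) in *.
  set (th := carg p q) in *; set (om := carg y (- (x - 2 * s))) in *.
  replace (phase s x y) with (th + (PI / 2 + om)) by lra.
  replace (x - 2 * s) with (- - (x - 2 * s)) by ring.
  replace ((x - 2 * s) ^ 2 + y ^ 2) with (y ^ 2 + (- (x - 2 * s)) ^ 2) in F by ring.
  set (v := - (x - 2 * s)) in *.
  assert (HT : exp (logmod s x y) = sqrt (p ^ 2 + q ^ 2) * sqrt (y ^ 2 + v ^ 2)).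
  { assert (0 <= p ^ 2 + q ^ 2) by nra; assert (0 <= y ^ 2 + v ^ 2) by nra.
    rewrite <- sqrt_mult by auto.
    rewrite <- (sqrt_pow2 (exp _)) by (left; apply exp_pos); f_equal; lra. }
  rewrite HT; set (r := sqrt (p ^ 2 + q ^ 2)) in *; set (r' := sqrt (y ^ 2 + v ^ 2)) in *.
  assert (Ec : cos (PI / 2 + om) = - sin om) by (rewrite cos_plus, cos_PI2, sin_PI2; ring).
  assert (Es : sin (PI / 2 + om) = cos om) by (rewrite sin_plus, cos_PI2, sin_PI2; ring).
  rewrite (cos_plus th), (sin_plus th), Ec, Es; clearbody th om r r' p q v.
  rewrite P1, P2, Q1, Q2; split; ring.
Qed.

Lemma complex_zero (s : R) : 0 < s < 1 ->
  (forall x, s + Rmin s (1 / 2) <= x <= s + Rmin s (1 / 2) + 1 / 2 -> 0 < real_gap s x) ->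
  exists x y, s + Rmin s (1 / 2) < x < s + Rmin s (1 / 2) + 1 / 2 /\ char_fun s (x, y) = 0%C.
Proof.
  intros Hs G; set (x0 := s + Rmin s (1 / 2)) in *.
  (* Clamping makes the curve total on the real line, so continuity at the end points needs no
     one-sided limits. *)
  set (X := fun t => Rmax x0 (Rmin t (x0 + 1 / 2))).
  assert (HX : forall t, x0 <= X t <= x0 + 1 / 2).
  { intros t; split; [apply Rmax_l | apply Rmax_lub; [lra | apply Rmin_r]]. }
  assert (HXid : forall t, x0 <= t <= x0 + 1 / 2 -> X t = t).
  { intros t Ht; unfold X; rewrite Rmin_left by lra; apply Rmax_right; lra. }
  assert (HXs : forall t, strip s (X t)) by (intros t; apply strip_mid; auto).
  set (Y := fun t => proj1_sig (constructive_indefinite_description _ (crossing_ex s (X t) (HXs t)))).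
  assert (HY : forall t, is_crossing s (X t) (Y t)).
  { intros t; unfold Y; now destruct constructive_indefinite_description. }
  assert (HXc : forall t, continuous X t).
  { intros t; apply filterlim_locally; intros eps; exists eps; intros u Hu.
    revert Hu; unfold ball; simpl; unfold AbsRing_ball, abs, minus, plus, opp; simpl.
    intros Hu; eapply Rle_lt_trans; [| exact Hu].
    unfold X, Rmax, Rmin, Rabs; repeat destruct Rle_dec; repeat destruct Rcase_abs; lra. }
  assert (HYc : forall t, continuous Y t).
  { intros t; now apply (crossing_continuous s X Y). }
  assert (Hcv : forall t, on_curve s (X t) (Y t)) by (intros t; split; auto).
  destruct (IVT_open (fun t => - arg_gap s (X t) (Y t)) x0 (x0 + 1 / 2)) as [t [Ht E]]; [lra | | |].
  - intros t _; apply (continuous_opp (V := R_NormedModule)); unfold arg_gap.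
    destruct (curve_args s (X t) (Y t) Hs (Hcv t) (G _ (HX t))) as [A1 A2].
    apply continuous_Rminus; [| apply (continuous_phase s X Y); auto].
    apply continuous_Rplus; [| apply continuous_Rplus; [apply continuous_const |]].
    + apply (continuous_carg (fun t => sin_re s (X t) (Y t)) (fun t => sin_im s (X t) (Y t)));
        auto; unfold sin_re, sin_im; continuous_tac.
    + apply (continuous_carg Y (fun t => - (X t - 2 * s))); auto.
      apply (continuous_opp (V := R_NormedModule)); continuous_tac.
  - assert (C0 := Hcv x0); assert (C1 := Hcv (x0 + 1 / 2)).
    rewrite HXid in C0, C1 |- * by lra; rewrite HXid by lra.
    assert (B0 := arg_gap_left s (Y x0) Hs C0).
    assert (B1 := arg_gap_right s (Y (x0 + 1 / 2)) Hs C1 (G (x0 + 1 / 2) ltac:(lra))).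
    unfold x0 in *; lra.
  - exists t, (Y t); split; auto.
    assert (Ct := Hcv t); rewrite HXid in Ct, E by lra.
    assert (Gt := G t ltac:(lra)).
    apply arg_mod_zero; auto; [| lra].
    destruct (proj1 (proj2 Ct)) as [Hy | Hy]; auto; exfalso.
    rewrite <- Hy in Ct, E; rewrite arg_gap_bottom in E by auto.
    assert (Hpi := PI_RGT_0); lra.
Qed.

Lemma char_fun_zero_ex (s : R) : 0 < s < 1 ->
  exists b, s + Rmin s (1 / 2) < Re b < s + Rmin s (1 / 2) + 1 / 2 /\ char_fun s b = 0%C.
Proof.
  intros Hs.
  destruct (excluded_middle_informative
    (exists x, s + Rmin s (1 / 2) <= x <= s + Rmin s (1 / 2) + 1 / 2 /\ real_gap s x <= 0))
    as [H | H].
  - destruct (real_zero s Hs H) as [x [Hx E]]; exists (x, 0); split; [exact Hx | exact E].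
  - destruct (complex_zero s Hs) as [x [y [Hx E]]]; [| exists (x, y); split; [exact Hx | exact E]].
    intros x Hx; destruct (Rlt_le_dec 0 (real_gap s x)); auto; exfalso; eauto.
Qed.

(** For s > 1/2 the pole 2 s of the prefactor lies inside the strip searched for a zero; there the
    sine term vanishes and the Gamma term does not. *)
Lemma char_fun_pole_neq_0 (s : R) : 0 < s < 1 -> char_fun s (2 * s) <> 0%C.
Proof.
  intros Hs; replace (2 * s)%C with ((2 * s, 0) : C) by (apply C_eq_parts; simpl; ring).
  assert (Hst : strip s (2 * s)) by (unfold strip; lra).
  rewrite char_fun_zero by auto; intros [A _]; revert A.
  rewrite phase_0, cos_0 by (auto; lra).
  assert (H := exp_pos (logmod s (2 * s) 0)); lra.
Qed.

Theorem proposition1p4 (s : R) (hs : 0 < s < 1) :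
  (s <= 1 / 2 ->
    (exists alpha : R, 0 < alpha /\
       forall beta : C, 0 < Re beta < 2 * s + alpha ->
         ~ meromorphic_zero (f_s s) beta) /\
    (exists beta : C, 2 * s < Re beta < 2 * s + 1 / 2 /\
       meromorphic_zero (f_s s) beta)) /\
  (1 / 2 <= s ->
    (exists alpha : R, 0 < alpha /\
       forall beta : C, 2 * s - 1 < Re beta < s + 1 / 2 + alpha ->
         ~ meromorphic_zero (f_s s) beta) /\
    (exists beta : C, s + 1 / 2 < Re beta < s + 1 /\
       meromorphic_zero (f_s s) beta)).
Proof.
  (* Both cases at once: s + min(s, 1/2) is 2 s or s + 1/2, and the larger of 0 and 2 s - 1 is the
     left edge in the statement. *)
  assert (Hfree : exists alpha, 0 < alpha /\ forall b, 0 < Re b -> 2 * s - 1 < Re b ->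
    Re b < s + Rmin s (1 / 2) + alpha -> ~ meromorphic_zero (f_s s) b).
  { destruct (zero_free_margin s hs) as [alpha [Ha H]].
    exists alpha; split; [lra |]; intros b H1 H2 H3 Hb.
    destruct (Rmin_half s) as [M1 M2].
    assert (Hm : Rmin s (1 / 2) < s + 1 / 2) by lra.
    assert (Hst : strip s (Re b)) by (unfold strip; lra).
    apply meromorphic_zero_char_fun in Hb; auto; revert Hb.
    destruct (Rle_lt_dec (Re b) (s + Rmin s (1 / 2))).
    - now apply char_fun_neq_0.
    - now apply H. }
  assert (Hex : exists b, s + Rmin s (1 / 2) < Re b < s + Rmin s (1 / 2) + 1 / 2 /\
    meromorphic_zero (f_s s) b).
  { destruct (char_fun_zero_ex s hs) as [b [Hb E]]; exists b; split; auto.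
    apply char_fun_meromorphic_zero; auto; [apply strip_mid; auto; lra |].
    intros ->; revert E; now apply char_fun_pole_neq_0. }
  destruct Hfree as [alpha [Ha H]], Hex as [b [Hb E]].
  split; intros Hh.
  - rewrite Rmin_left in H, Hb by lra; split; [exists alpha | exists b]; split; auto; try lra.
    intros b' Hb'; apply H; lra.
  - rewrite Rmin_right in H, Hb by lra; split; [exists alpha | exists b]; split; auto; try lra.
    intros b' Hb'; apply H; lra.
Qed.
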